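(* Let $q\ge1$, $c>0$, $f\in L^2(Q_T)$, $u_0\in H_0^1(\Omega)$, $v_0\in L^2(\Omega)$, $\Upsilon\in L^2(0,T;H_0^1(\Omega))$. There is a constant $C>0$ depending only on $q$ such that any pair $(u_{h\tau},v_{h\tau})\in\mathring{\mathcal V}_{h\tau}^{\mathsf{disc}(q)}\times\mathring{\mathcal V}_{h\tau}^{\mathsf{disc}(q)}$ satisfying, for all $z_{h\tau},w_{h\tau}\in\mathring{\mathcal V}_{h\tau}^{\mathsf{disc}(q)}$, $$c^2(\nabla v_{h\tau},\nabla z_{h\tau})_{Q_T}=c^2D_\tau(\nabla u_{h\tau},\nabla z_{h\tau})-c^2(\nabla u_0,\nabla z_{h\tau}(\cdot,0))_\Omega+c^2(\nabla\Upsilon,\nabla z_{h\tau})_{Q_T},$$ $$D_\tau(v_{h\tau},w_{h\tau})+c^2(\nabla u_{h\tau},\nabla w_{h\tau})_{Q_T}=(f,w_{h\tau})_{Q_T}+(v_0,w_{h\tau}(\cdot,0))_\Omega,$$ satisfies $$\|v_{h\tau}\|_{L^\infty(0,T;L^2(\Omega))}^2+c^2\|\nabla u_{h\tau}\|_{L^\infty(0,T;L^2(\Omega)^d)}^2\le C\Big(\|f\|_{L^1(0,T;L^2(\Omega))}^2+c^2\|\nabla\Upsilon\|_{L^1(0,T;L^2(\Omega)^d)}^2+\|v_0\|_{L^2(\Omega)}^2+c^2\|\nabla u_0\|_{L^2(\Omega)^d}^2\Big).$$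
   Context: Setting: $\Omega\subset\mathbb R^d$ ($d\in\{1,2,3\}$) is a polytopic domain, $T>0$, $Q_T=\Omega\times(0,T)$. $\mathcal T_h$ is a shape-regular conforming simplicial mesh of $\Omega$ with meshsize $h$. $0=t_0<t_1<\dots<t_N=T$ is an arbitrary partition (no quasi-uniformity), $I_n=(t_{n-1},t_n)$, $\tau_n=t_n-t_{n-1}$, $\tau=\max_n\tau_n$, $Q_n=\Omega\times I_n$. $(\cdot,\cdot)_D$ is the $L^2(D)$ (or $L^2(D)^d$) inner product. $p\ge1$ is an integer. Spaces: $\mathring{\mathcal V}_h^p=\{v_h\in H_0^1(\Omega): v_h|_K\in\mathbb P^p(K)\ \forall K\in\mathcal T_h\}$; $\mathring{\mathcal V}_{h\tau}^{\mathsf{disc}(q)}$ is the space of functions whose restriction to each $Q_n$ lies in $\mathbb P^q(I_n)\otimes\mathring{\mathcal V}_h^p$ (no continuity in time across the $t_n$). Jumps: $[\![v]\!]_n=v(t_n^+)-v(t_n^-)$ for $n=1,\dots,N-1$; values at $t=0$ are one-sided traces from inside $(0,T)$. DG discretization of the time derivative (for scalar- or vector-valued piecewise polynomials in time): $$D_\tau(v,w)=\sum_{n=1}^N(\partial_tv,w)_{Q_n}+\sum_{n=1}^{N-1}([\![v]\!]_n,w(\cdot,t_n^+))_\Omega+(v(\cdot,0),w(\cdot,0))_\Omega.$$ *)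

(* Defs.v *)
From HB Require Import structures.
From mathcomp Require Import all_boot all_order all_algebra finmap.
From mathcomp Require Import all_classical all_reals all_analysis ess_sup_inf.
Set Implicit Arguments.
Unset Strict Implicit.
Unset Printing Implicit Defensive.
Import Order.TTheory GRing.Theory Num.Theory.
Import numFieldNormedType.Exports.
Local Open Scope classical_set_scope.
Local Open Scope ring_scope.

Definition rV_display : measure_display.
Proof. exact: default_measure_display. Qed.

Section measurable_rV.
Context {R : realType} (d : nat).

Let coord (i : 'I_d) (x : 'rV[R]_d) : measurableTypeR R := x ord0 i.

Let rV_set0 : g_sigma_preimage coord set0.
Proof. exact: sigma_algebra0. Qed.

Let rV_setC A : g_sigma_preimage coord A -> g_sigma_preimage coord (~` A).
Proof. exact: sigma_algebraC. Qed.

Let rV_bigcup (F : (set 'rV[R]_d)^nat) :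
  (forall i, g_sigma_preimage coord (F i)) ->
  g_sigma_preimage coord (\bigcup_i (F i)).
Proof. exact: sigma_algebra_bigcup. Qed.

HB.instance Definition _ := @isMeasurable.Build rV_display
  'rV[R]_d (g_sigma_preimage coord) rV_set0 rV_setC rV_bigcup.

Lemma measurable_coord (i : 'I_d) : measurable_fun [set: 'rV[R]_d] (coord i).
Proof.
move=> _ Y mY; rewrite setTI; apply: sub_sigma_algebra => /=.
rewrite -bigcup_seq/=; exists i => /=; first by rewrite mem_index_enum.
by exists Y => //; rewrite setTI.
Qed.

Lemma measurable_fun_rV d' (T : measurableType d') (f : T -> 'rV[R]_d) :
  (forall i, measurable_fun [set: T] (coord i \o f)) ->
  measurable_fun [set: T] f.
Proof.
move=> mf _ A mA; rewrite setTI.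
pose F := [set B : set 'rV[R]_d | measurable (f @^-1` B)].
suff : F A by [].
apply: mA; split.
  split.
  - by rewrite /F /= preimage_set0.
  - by move=> B FB; rewrite /F /= setTD preimage_setC; exact: measurableC.
  - by move=> G FG; rewrite /F /= preimage_bigcup; exact: bigcupT_measurable.
rewrite -bigcup_seq => B [i _ [C mC <-]]; rewrite /F /= setTI.
by have := mf i measurableT C mC; rewrite setTI.
Qed.

End measurable_rV.

Section lebesgue_rV_succ.
Context {R : realType} (d : nat).
Variable nu : {sigma_finite_measure set (measurableTypeR R) -> \bar R}.
Variable mu : {sigma_finite_measure set 'rV[R]_d -> \bar R}.

Definition rV_cons (p : measurableTypeR R * 'rV[R]_d) : 'rV[R]_d.+1 :=
  row_mx (p.1 : R)%:M p.2.

Definition rV_uncons (x : 'rV[R]_d.+1) : measurableTypeR R * 'rV[R]_d :=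
  (x ord0 ord0, @rsubmx R 1 1 d x).

Lemma rV_consK : cancel rV_cons rV_uncons.
Proof.
move=> [a y]; rewrite /rV_uncons /rV_cons /= row_mxKr; congr pair.
have e : lshift d (ord0 : 'I_1) = (ord0 : 'I_d.+1) by exact/val_inj.
have := @row_mxEl R 1 1 d (a : R)%:M y ord0 ord0.
by rewrite e [in RHS]mxE eqxx mulr1n.
Qed.

Lemma measurable_rV_cons : measurable_fun [set: _] rV_cons.
Proof.
apply: measurable_fun_rV => i.
case: (@split_ordP 1 d i) => j ij.
- apply: (eq_measurable_fun fst) => // p _.
  have := @row_mxEl R 1 1 d (p.1 : R)%:M p.2 ord0 j.
  by rewrite -ij [in RHS]mxE (ord1 j) eqxx mulr1n.
- apply: (eq_measurable_fun
      (fun p : measurableTypeR R * 'rV[R]_d => p.2 ord0 j : measurableTypeR R)).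
    move=> p _.
    have := @row_mxEr R 1 1 d (p.1 : R)%:M p.2 ord0 j.
    by rewrite -ij.
  apply: (measurableT_comp
    (f := fun x : 'rV[R]_d => x ord0 j : measurableTypeR R)).
    exact: measurable_coord.
  exact: measurable_snd.
Qed.

Lemma measurable_rV_uncons : measurable_fun [set: _] rV_uncons.
Proof.
apply: measurable_fun_pair; first exact: measurable_coord.
apply: measurable_fun_rV => i.
apply: (eq_measurable_fun
  (fun x : 'rV[R]_d.+1 => x ord0 (rshift 1 i) : measurableTypeR R)).
  by move=> x _; rewrite /= mxE.
exact: measurable_coord.
Qed.

Definition lebesgue_rV_succ : set 'rV[R]_d.+1 -> \bar R :=
  pushforward (nu \x mu)%E rV_cons.

Let lebesgue_rV_succ0 : lebesgue_rV_succ set0 = 0%E.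
Proof. by rewrite /lebesgue_rV_succ /pushforward preimage_set0 measure0. Qed.

Let lebesgue_rV_succ_ge0 A : (0 <= lebesgue_rV_succ A)%E.
Proof. by rewrite /lebesgue_rV_succ /pushforward; exact: measure_ge0. Qed.

Let lebesgue_rV_succ_sigma_additive : semi_sigma_additive lebesgue_rV_succ.
Proof.
move=> F mF tF mUF; rewrite /lebesgue_rV_succ /pushforward preimage_bigcup.
apply: measure_semi_sigma_additive.
- by move=> n; rewrite -[X in measurable X]setTI; exact: measurable_rV_cons.
- apply/trivIsetP => /= i j _ _ ij; rewrite -preimage_setI.
  by move/trivIsetP : tF => /(_ _ _ _ _ ij) ->//; rewrite preimage_set0.
- rewrite -preimage_bigcup -[X in measurable X]setTI.
  exact: measurable_rV_cons.
Qed.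

HB.instance Definition _ := isMeasure.Build _ _ _ lebesgue_rV_succ
  lebesgue_rV_succ0 lebesgue_rV_succ_ge0 lebesgue_rV_succ_sigma_additive.

Let lebesgue_rV_succ_sigma_finite : sigma_finite setT lebesgue_rV_succ.
Proof.
have /sigma_finiteP[F [TF ndF Foo]] := sigma_finiteT nu.
have /sigma_finiteP[G [TG ndG Goo]] := sigma_finiteT mu.
exists (fun n => rV_uncons @^-1` (F n `*` G n)).
  rewrite -preimage_bigcup (_ : \bigcup_n _ = setT) ?preimage_setT//.
  rewrite -subTset => -[x y] _.
  have [n _ Fnx] : (\bigcup_n F n) x by rewrite -TF.
  have [k _ Gky] : (\bigcup_n G n) y by rewrite -TG.
  exists (maxn n k) => //; split.
  - by move: x Fnx; exact/subsetPset/ndF/leq_maxl.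
  - by move: y Gky; exact/subsetPset/ndG/leq_maxr.
move=> k; have [mF muF] := Foo k; have [mG muG] := Goo k.
have mFG : measurable (F k `*` G k) by exact: measurableX.
split; first by rewrite -[X in measurable X]setTI; exact: measurable_rV_uncons.
rewrite /lebesgue_rV_succ /pushforward -comp_preimage.
rewrite (_ : rV_uncons \o rV_cons = id); last first.
  by rewrite funeqE; exact: rV_consK.
rewrite preimage_id product_measure1E//.
by rewrite lte_mul_pinfty// ge0_fin_numE.
Qed.

HB.instance Definition _ := Measure_isSigmaFinite.Build _ _ _ lebesgue_rV_succ
  lebesgue_rV_succ_sigma_finite.

End lebesgue_rV_succ.

(* Iterated product of the one-dimensional Lebesgue measure, on the product
   sigma-algebra of R^d *)
Fixpoint lebesgue_rV {R : realType} (d : nat) :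
    {sigma_finite_measure set 'rV[R]_d -> \bar R} :=
  match d with
  | 0%N => \d_(0 : 'rV[R]_0)
  | d'.+1 => lebesgue_rV_succ lebesgue_measure (lebesgue_rV d')
  end.

(* An H^1 function is given by a representative together with a representative
   of its weak gradient; the latter is determined a.e. by the former.  Pairs of
   functions inherit their vector space structure from the library. *)
Notation sobolev R d :=
  (('rV[R]_d -> R) * ('rV[R]_d -> 'rV[R]_d))%type.

Section sobolev.
Context {R : realType} {d : nat}.
Local Notation X := 'rV[R]_d.
Local Notation mu := (@lebesgue_rV R d).
Implicit Types (Om : set X) (f : X -> R) (g : X -> X).

Definition smul (a b : R) : R := a * b.

Definition dot (a b : X) : R := \sum_i a ord0 i * b ord0 i.

Definition partial (i : 'I_d) f : X -> R := fun x => 'D_(delta_mx ord0 i) f x.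

Definition classical_grad f : X -> X := fun x => \row_i partial i f x.

Fixpoint Ck (k : nat) f : Prop :=
  match k with
  | 0%N => continuous f
  | k'.+1 => [/\ continuous f,
                 forall x i, derivable f x (delta_mx ord0 i) &
                 forall i, Ck k' (partial i f)]
  end.

(* C_c^oo(Om) *)
Definition test_function Om f : Prop :=
  let supp := closure [set x | f x != 0] in
  [/\ forall k, Ck k f, compact supp & supp `<=` Om].

Definition L2 Om f : Prop :=
  measurable_fun Om f /\ (\int[mu]_(x in Om) ((f x) ^+ 2)%:E < +oo)%E.

Definition L2vec Om g : Prop := forall i, L2 Om (fun x => g x ord0 i).

(* The inner product and norm of L^2(Om; V), where V carries the inner product
   ip; used with V = R, ip = smul and with V = R^d, ip = dot. *)
Definition innerL2 (V : Type) (ip : V -> V -> R) Om (u v : X -> V) : R :=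
  \int[mu]_(x in Om) ip (u x) (v x).

Definition normL2 (V : Type) (ip : V -> V -> R) Om (u : X -> V) : \bar R :=
  ((\int[mu]_(x in Om) (ip (u x) (u x))%:E) `^ 2^-1)%E.

Definition weak_gradient Om f g : Prop :=
  forall phi, test_function Om phi -> forall i : 'I_d,
    \int[mu]_(x in Om) (f x * partial i phi x) =
    - \int[mu]_(x in Om) (g x ord0 i * phi x).

Definition fval (u : sobolev R d) : X -> R := u.1.
Definition grad (u : sobolev R d) : X -> X := u.2.

Definition H1 Om (u : sobolev R d) : Prop :=
  [/\ L2 Om (fval u), L2vec Om (grad u) & weak_gradient Om (fval u) (grad u)].

Definition normH1 Om (u : sobolev R d) : \bar R :=
  ((normL2 smul Om (fval u) ^+ 2 + normL2 dot Om (grad u) ^+ 2) `^ 2^-1)%E.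

(* H^1_0(Om): the closure of C_c^oo(Om) in H^1(Om) *)
Definition H10 Om (u : sobolev R d) : Prop :=
  H1 Om u /\
  exists phi : nat -> X -> R, (forall k, test_function Om (phi k)) /\
    (fun k => normH1 Om (u - (phi k, classical_grad (phi k)) : sobolev R d))
      @ \oo --> 0%E.

End sobolev.

Section mesh.
Context {R : realType} {d : nat}.
Local Notation X := 'rV[R]_d.
Implicit Types (Om : set X) (S K : {fset X}) (Th : {fset {fset X}}).

Definition convex_hull S : set X :=
  [set x | exists a : X -> R, [/\ forall v, v \in S -> 0 <= a v,
     \sum_(v <- S) a v = 1 & x = \sum_(v <- S) a v *: v]].

Definition affinely_independent S : Prop :=
  forall a : X -> R, \sum_(v <- S) a v = 0 -> \sum_(v <- S) a v *: v = 0 ->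
  forall v, v \in S -> a v = 0.

(* Finite unions of convex polytopes cover the non-convex polytopes; taking the
   interior rules out slit domains. *)
Definition polytopic_domain Om : Prop :=
  [/\ Om !=set0, connected Om &
      exists P : {fset {fset X}},
        Om = interior (\bigcup_(S in [set` P]) convex_hull S)].

Definition simplex_vertices K : Prop :=
  #|` K| = d.+1 /\ affinely_independent K.

(* A mesh is the set of the vertex sets of its (closed) elements. *)
Definition conforming_mesh Om Th : Prop :=
  [/\ forall K, K \in Th -> simplex_vertices K,
      closure Om = \bigcup_(K in [set` Th]) convex_hull K &
      forall K K', K \in Th -> K' \in Th ->
        convex_hull K `&` convex_hull K' = convex_hull (K `&` K')%fset].

Definition edist (x y : X) : R := Num.sqrt (dot (x - y) (x - y)).

Definition diameter K : R :=
  sup [set r | exists x y, [/\ convex_hull K x, convex_hull K y &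
                               r = edist x y]].

Definition inradius K : R :=
  sup [set r | 0 <= r /\
               exists x, [set y | edist x y <= r] `<=` convex_hull K].

Definition shape_regular (sigma : R) Th : Prop :=
  forall K, K \in Th -> diameter K <= sigma * inradius K.

Definition polynomial_on (p : nat) (D : set X) (f : X -> R) : Prop :=
  exists c : {ffun 'I_d -> 'I_p.+1} -> R, forall x, D x ->
    f x = \sum_(al : {ffun 'I_d -> 'I_p.+1} | (\sum_i al i <= p)%N)
            c al * \prod_i x ord0 i ^+ al i.

Definition Vh Om Th (p : nat) (v : sobolev R d) : Prop :=
  H10 Om v /\
  forall K, K \in Th -> polynomial_on p (convex_hull K) (fval v).

End mesh.

Section spacetime.
Context {R : realType} {d : nat}.
Local Notation X := 'rV[R]_d.
Local Notation mu := (@lebesgue_rV R d).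
Local Notation lambda := (@lebesgue_measure R).
Implicit Types (Om : set X) (T : R) (N : nat) (ts : nat -> R).

Definition time_partition T N ts : Prop :=
  [/\ ts 0%N = 0, ts N = T & forall n, (n < N)%N -> ts n < ts n.+1].

Definition L2_QT Om T (f : R -> X -> R) : Prop :=
  let QT := Om `*` `]0, T[%classic in
  measurable_fun QT (fun z : X * measurableTypeR R => f z.2 z.1) /\
  (\int[mu \x lambda]_(z in QT) ((f z.2 z.1) ^+ 2)%:E < +oo)%E.

Definition simple_H10 Om T (s : R -> sobolev R d) : Prop :=
  exists m (A : 'I_m -> set R) (phi : 'I_m -> sobolev R d),
    (forall j, measurable (A j) /\ H10 Om (phi j)) /\
    forall t, 0 < t < T -> s t = \sum_(j < m) \1_(A j) t *: phi j.

(* The Bochner space L^2(0, T; H^1_0(Om)), through Borel representatives: the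
   simple functions converge at every time of (0, T), not only at almost every
   one. *)
Definition L2_H10 Om T (U : R -> sobolev R d) : Prop :=
  [/\ forall t, 0 < t < T -> H10 Om (U t),
      exists s : nat -> R -> sobolev R d,
        (forall k, simple_H10 Om T (s k)) /\
        forall t, 0 < t < T ->
          (fun k => normH1 Om (s k t - U t)) @ \oo --> 0%E &
      (\int[lambda]_(t in `]0%R, T[) (normH1 Om (U t) ^+ 2) < +oo)%E].

Definition Vdisc Om (Th : {fset {fset X}}) (p N : nat) ts (q : nat)
    (v : R -> sobolev R d) : Prop :=
  forall n, (n < N)%N ->
    exists phi : 'I_q.+1 -> sobolev R d,
      (forall j, Vh Om Th p (phi j)) /\
      forall t, ts n < t < ts n.+1 -> v t = \sum_(j < q.+1) t ^+ j *: phi j.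

Section vector_valued.
Context {V : normedModType R} (ip : V -> V -> R) (Om : set X).
Implicit Types v w : R -> X -> V.

(* The L^2(Om x (a, b)) inner product, as an iterated integral *)
Definition inner_slab (a b : R) v w : R :=
  \int[lambda]_(t in `]a, b[) innerL2 ip Om (v t) (w t).

Definition dt v : R -> X -> V := fun t x => derive1 (fun s => v s x) t.

Definition trace_right v (t : R) : X -> V := fun x => lim (v s x @[s --> t^'+]).
Definition trace_left v (t : R) : X -> V := fun x => lim (v s x @[s --> t^'-]).

Definition jump v (t : R) : X -> V :=
  fun x => trace_right v t x - trace_left v t x.

Definition Dtau N ts v w : R :=
  \sum_(1 <= n < N.+1) inner_slab (ts n.-1) (ts n) (dt v) w
  + \sum_(1 <= n < N)
      innerL2 ip Om (jump v (ts n)) (trace_right w (ts n))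
  + innerL2 ip Om (trace_right v 0) (trace_right w 0).

Definition normL1L2 T v : \bar R :=
  (\int[lambda]_(t in `]0%R, T[) normL2 ip Om (v t))%E.

Definition normLooL2 T v : \bar R :=
  ess_sup lambda ((fun t => normL2 ip Om (v t)) \_ `]0, T[).

End vector_valued.

End spacetime.

(* Main.v *)
(** With the energy [E(v, w) = |v|^2 + c^2 |w|^2] of the pair
    [Y = (v, grad u)], both equations tested on one time slab combine into a
    single discontinuous Galerkin step for [Y].  Two test functions, supported in
    that slab, make the coupling terms cancel: [Y] itself, and the
    [L^2]-projection onto polynomials of degree [q] of [s Y(s)], where [s] in
    [0, 1] is the local time.  The first gives
      [E(Y_(n+1)^-) + E(J_n) <= E(Y_n^-) + 2 y_n D_n],
    where [J_n] is the jump, [D_n] the [L^1] norm of the data on the slab and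
    [y_n] bounds both test functions on it; the second gives
      [Q_n <= E(Y_(n+1)^-) + 2 |J_n| y_n + 2 y_n D_n]
    for the mean [Q_n] of [E(Y)] over the slab.  The reproducing kernel of the
    polynomials of degree [q] on [0, 1] allows [y_n^2 = K Q_n] with [K] depending
    on [q] only.  Evaluating at the slab where [y_n] is largest and absorbing with
    Young's inequality bounds [y_n^2] by the squared data. *)

Require Import Defs.
From HB Require Import structures.
From mathcomp Require Import all_boot all_order all_algebra finmap.
From mathcomp Require Import all_classical all_reals all_analysis.
From mathcomp Require Import measurable_realfun ess_sup_inf.
From mathcomp Require Import ring lra zify.
Set Implicit Arguments.
Unset Strict Implicit.
Unset Printing Implicit Defensive.
Import Order.TTheory GRing.Theory Num.Theory.
Import numFieldNormedType.Exports.
Local Open Scope classical_set_scope.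
Local Open Scope ring_scope.

(** * Integrals of polynomials on the unit interval *)

(** Testing with [Y] controls the solution only at the nodes and in the jumps, while the data are
    paired with its values inside the slabs, so the energy inequality alone does not close; the
    weight [s] recovers the interior. Since [s Y(s)] has degree [q + 1], it has to be projected.
    Against [Y'], of degree below [q], the projection is invisible, but it need not vanish at
    [s = 0]: this is the origin of the term [2 |J_n| y_n]. The coupling still cancels because
    multiplication by [s] followed by projection is self-adjoint on polynomials of degree [q]. No
    constant sees the mesh or the time steps. After rescaling to the unit interval, the factor
    produced by the time derivative cancels the slab length, and values are bounded by means through
    scalar polynomials only; the functions of [x] enter merely through a semi-inner product. The
    data enter as [L^1] norms, which add up over the slabs against the largest [y_n], so that no
    Gronwall argument is involved and neither [T] nor the partition enters the constant. *)

Section poly_integral.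
Context {R : realType}.
Implicit Types (p g h : {poly R}) (s a b : R) (q : nat).

(* The constant coefficient is [p`_0 / 0 = 0]. *)
Definition prim p : {poly R} := \poly_(i < (size p).+1) (p`_i.-1 / i%:R).

Lemma coef_prim p i : (prim p)`_i = p`_i.-1 / i%:R.
Proof.
rewrite coef_poly; case: ltnP => // hi; case: i hi => [|i] //= hi.
by rewrite nth_default ?mul0r.
Qed.

Lemma deriv_prim p : (prim p)^`() = p.
Proof.
by apply/polyP => i; rewrite coef_deriv coef_prim -[LHS]mulr_natr divfK ?pnatr_eq0.
Qed.

Lemma prim0 p : (prim p).[0] = 0.
Proof. by rewrite horner_coef0 coef_prim invr0 mulr0. Qed.

(** A formal integral over [0, 1], linear by construction: the argument on a slab becomes algebra on
    coefficients, free of integrability conditions. *)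
Definition pint p : R := (prim p).[1].

Lemma pint_is_linear : scalar pint.
Proof.
move=> a p g; rewrite /pint; have -> : prim (a *: p + g) = a *: prim p + prim g.
  apply/polyP => i.
  by rewrite coefD coefZ !coef_prim coefD coefZ mulrDl mulrA.
by rewrite hornerD hornerZ.
Qed.

HB.instance Definition _ :=
  GRing.isLinear.Build R {poly R} R _ pint pint_is_linear.

Lemma pintZ a p : pint (a *: p) = a * pint p.
Proof. exact: linearZ. Qed.

Lemma pintD p g : pint (p + g) = pint p + pint g.
Proof. exact: linearD. Qed.

Lemma pint_deriv p : pint p^`() = p.[1] - p.[0].
Proof.
have e : prim p^`() = p - (p`_0)%:P.
  apply/polyP => -[|i]; rewrite coef_prim /= coefB coefC /=.
    by rewrite invr0 mulr0 subrr.
  by rewrite coef_deriv subr0 -[X in X / _]mulr_natr mulfK ?pnatr_eq0.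
by rewrite /pint e hornerD hornerN hornerC horner_coef0.
Qed.

Lemma integral_deriv_poly p a b : a < b ->
  \int[lebesgue_measure]_(t in `]a, b[) p^`().[t] = p.[b] - p.[a].
Proof.
move=> ab.
have cp g : {within `[a, b], continuous (horner g)}.
  by apply: continuous_subspaceT => x; exact: continuous_horner.
have ig g : lebesgue_measure.-integrable `[a, b]%classic (EFin \o horner g).
  by apply: continuous_compact_integrable; [exact: segment_compact|exact: cp].
rewrite Rintegral_itv_bndo_bndc; last first.
  by apply: integrableS (ig _) => //; exact: subset_itv_oo_cc.
rewrite Rintegral_itv_obnd_cbnd; last first.
  by apply: integrableS (ig _) => //; exact: subset_itv_oc_cc.
rewrite /Rintegral (continuous_FTC2 (F := horner p)) //.
  split; first by move=> x _; exact: derivable_horner.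
    by apply: cvg_at_right_filter; exact: continuous_horner.
  by apply: cvg_at_left_filter; exact: continuous_horner.
by move=> x _; rewrite -derivE.
Qed.

(** The affine substitution is carried out on the primitive: [prim p] composed with the affine map,
    times [b - a], is a primitive of the integrand. *)
Lemma integral_rescale_poly p a b : a < b ->
  \int[lebesgue_measure]_(t in `]a, b[) p.[(t - a) / (b - a)] =
  (b - a) * pint p.
Proof.
move=> ab; have ba0 : b - a != 0 by rewrite subr_eq0 gt_eqF.
pose L : {poly R} := (b - a)^-1 *: ('X - a%:P).
have HL t : L.[t] = (t - a) / (b - a) by rewrite !hornerE mulrC.
pose G := (b - a) *: (prim p \Po L).
have G'E : G^`() = p \Po L.
  rewrite /G derivZ deriv_comp deriv_prim /L derivZ derivXsubC.
  by rewrite -scalerAr mulr1 scalerA divff // scale1r.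
transitivity (\int[lebesgue_measure]_(t in `]a, b[) (G^`()).[t]).
  by apply: eq_Rintegral => t _; rewrite G'E horner_comp HL.
rewrite integral_deriv_poly // /G !hornerZ !horner_comp !HL subrr mul0r.
by rewrite prim0 mulr0 subr0 divff.
Qed.

Lemma pint_ge0 p : (forall s, 0 <= s <= 1 -> 0 <= p.[s]) -> 0 <= pint p.
Proof.
move=> p0; have := @integral_deriv_poly (prim p) 0 1 ltr01.
rewrite prim0 subr0 -/(pint p) => <-; apply: Rintegral_ge0 => t /=.
by rewrite in_itv /= => /andP[t0 t1]; rewrite deriv_prim p0 // !ltW.
Qed.

(** The primitive of [p ^+ 2] is nondecreasing and vanishes at 0 and at 1, hence on all of (0, 1);
    it has too many roots to be nonzero. *)
Lemma pint_sqr_eq0 p : pint (p ^+ 2) = 0 -> p = 0.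
Proof.
move=> p0; pose G := prim (p ^+ 2).
have mono a b : a < b -> G.[a] <= G.[b].
  move=> ab; rewrite -subr_ge0 -(integral_deriv_poly G ab).
  apply: Rintegral_ge0 => t _; rewrite deriv_prim horner_exp; exact: sqr_ge0.
have G0 s : 0 < s -> s < 1 -> G.[s] = 0.
  move=> s0 s1; apply/eqP; rewrite eq_le -[X in _ <= X]p0 /pint (mono _ _ s1) /=.
  by rewrite -(prim0 (p ^+ 2)) mono.
suff : G = 0.
  move=> /(congr1 (@deriv _)); rewrite deriv_prim deriv0 => /eqP.
  by rewrite expf_eq0 /= => /eqP.
apply/eqP; apply: contraT => Gn0.
(* The points [1 / (i + 2)] lie in (0, 1), and there are [size G] of them, one more than the degree
   of [G]. *)
pose rs := [seq (i.+2%:R : R)^-1 | i <- iota 0 (size G)].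
have : (size rs < size G)%N.
  apply: max_poly_roots => //.
    apply/allP => _ /mapP[i _ ->]; rewrite /root G0 // ?invr_gt0 ?ltr0n //.
    by rewrite invf_lt1 ?ltr0n // ltr1n.
  rewrite map_inj_uniq ?iota_uniq // => i j /invr_inj /eqP.
  by rewrite eqr_nat => /eqP [].
by rewrite size_map size_iota ltnn.
Qed.

(** * Gram matrix of the monomials, orthogonal projection and reproducing kernel *)

Definition gram q : 'M[R]_q.+1 := \matrix_(i, j) pint ('X^i * 'X^j).

(** A vector in the kernel is the coefficient vector of a polynomial orthogonal to all monomials up
    to degree [q], hence to itself. *)
Lemma gram_unit q : gram q \in unitmx.
Proof.
rewrite -row_free_unit -kermx_eq0; apply/eqP/row_matrixP => k.
rewrite row0; set u := row k _.
have uG : u *m gram q = 0.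
  by rewrite /u -row_mul mulmx_ker row0.
pose p := \sum_(i < q.+1) u ord0 i *: 'X^i : {poly R}.
have pX (j : 'I_q.+1) : pint (p * 'X^j) = 0.
  move: uG => /matrixP /(_ ord0 j); rewrite !mxE => <-.
  rewrite /p mulr_suml linear_sum; apply: eq_bigr => i _.
  by rewrite !mxE -scalerAl linearZ.
have p0 : p = 0.
  apply: pint_sqr_eq0; rewrite expr2 {2}/p mulr_sumr linear_sum big1 // => i _.
  by rewrite -scalerAr linearZ /= pX mulr0.
apply/rowP => i; rewrite [RHS]mxE.
have := congr1 (fun g : {poly R} => g`_i) p0; rewrite coef0 => <-.
rewrite /p coef_sum (bigD1 i) //= coefZ coefXn eqxx mulr1 big1 ?addr0 // => j.
move=> ji; rewrite coefZ coefXn eq_sym.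
by rewrite (_ : (_ == _) = false) ?mulr0 //; apply/negbTE.
Qed.

Lemma size_lin_comb m q (a : 'I_m -> R) (P : 'I_m -> {poly R}) :
  (forall j, (size (P j) <= q)%N) -> (size (\sum_j a j *: P j)%R <= q)%N.
Proof.
move=> sP; apply: (big_ind (fun p : {poly R} => (size p <= q)%N)).
- by rewrite size_poly0.
- by move=> p g hp hg; rewrite (leq_trans (size_polyD _ _)) // geq_max hp.
- by move=> j _; rewrite (leq_trans (size_scale_leq _ _)).
Qed.

Definition dualX q (j : 'I_q.+1) : {poly R} :=
  \sum_(i < q.+1) invmx (gram q) i j *: 'X^i.

Lemma size_dualX q (j : 'I_q.+1) : (size (dualX j) <= q.+1)%N.
Proof.
by apply: size_lin_comb => i; rewrite size_polyXn; exact: ltn_ord.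
Qed.

Lemma pint_dualX q (i j : 'I_q.+1) : pint ('X^i * dualX j) = (i == j)%:R.
Proof.
have := mulmxV (gram_unit q) => /matrixP /(_ i j); rewrite !mxE => <-.
rewrite mulr_sumr linear_sum; apply: eq_bigr => k _.
by rewrite -scalerAr linearZ /= mxE mulrC.
Qed.

Lemma poly_sumX q p : (size p <= q.+1)%N -> p = \sum_(i < q.+1) p`_i *: 'X^i.
Proof.
move=> sp; rewrite -[LHS]coefK poly_def.
rewrite (big_ord_widen _ (fun i => p`_i *: 'X^i) sp) big_mkcond /=.
by apply: eq_bigr => i _; case: ltnP => // /(nth_default 0) ->; rewrite scale0r.
Qed.

Lemma pint_mul_ext q g h p : (size p <= q.+1)%N ->
  (forall i : 'I_q.+1, pint ('X^i * g) = pint ('X^i * h)) ->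
  pint (p * g) = pint (p * h).
Proof.
move=> sp gh; rewrite (poly_sumX sp) !mulr_suml !linear_sum /=.
by apply: eq_bigr => i _; rewrite -!scalerAl !linearZ /= gh.
Qed.

(** The orthogonal projection onto degree at most [q]: in the basis dual to the monomials, the
    coordinates are the moments of [g]. *)
Definition proj q g : {poly R} := \sum_(j < q.+1) pint ('X^j * g) *: dualX j.

Lemma size_proj q g : (size (proj q g) <= q.+1)%N.
Proof. by apply: size_lin_comb => j; exact: size_dualX. Qed.

Lemma pint_proj q g p : (size p <= q.+1)%N -> pint (p * proj q g) = pint (p * g).
Proof.
move=> sp; apply: pint_mul_ext sp _ => i.
rewrite /proj mulr_sumr linear_sum (bigD1 i) //= -scalerAr linearZ /= pint_dualX.
rewrite eqxx mulr1 big1 ?addr0 // => j ji.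
by rewrite -scalerAr linearZ /= pint_dualX eq_sym (negbTE ji) mulr0.
Qed.

(** The representer of evaluation at [s]: its moment against ['X^j] has to be [s ^+ j]. *)
Definition rkernel q s : {poly R} := \sum_(j < q.+1) s ^+ j *: dualX j.

Lemma size_rkernel q s : (size (rkernel q s) <= q.+1)%N.
Proof. by apply: size_lin_comb => j; exact: size_dualX. Qed.

Lemma rkernelP q s p : (size p <= q.+1)%N -> pint (p * rkernel q s) = p.[s].
Proof.
move=> sp; rewrite [in LHS](poly_sumX sp) [in RHS](poly_sumX sp) horner_sum.
rewrite mulr_suml linear_sum; apply: eq_bigr => i _.
rewrite -scalerAl linearZ hornerZ hornerXn /=; congr (_ * _).
rewrite /rkernel mulr_sumr linear_sum (bigD1 i) //= -scalerAr linearZ /=.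
rewrite pint_dualX eqxx mulr1 big1 ?addr0 // => j ji.
by rewrite -scalerAr linearZ /= pint_dualX eq_sym (negbTE ji) mulr0.
Qed.

(** The double sum bounds the squared norm of every [rkernel q s], because its expansion has the
    weights [s ^+ (i + j)], at most 1 on [0, 1]. The summand 1 makes the constant positive. *)
Definition rkernel_bound q : R :=
  1 + \sum_(i < q.+1) \sum_(j < q.+1) `|pint (dualX i * dualX j)|.

Lemma rkernel_bound_ge1 q : 1 <= rkernel_bound q.
Proof. by rewrite lerDl; do 2 apply: sumr_ge0 => ? _. Qed.

Lemma pint_rkernel_sqr q s : 0 <= s <= 1 ->
  pint (rkernel q s ^+ 2) <= rkernel_bound q.
Proof.
move=> /andP[s0 s1]; apply: (@le_trans _ _ (rkernel_bound q - 1)); last first.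
  by rewrite gerBl.
rewrite /rkernel_bound addrC addKr expr2 /rkernel mulr_suml linear_sum.
apply: ler_sum => i _; rewrite mulr_sumr linear_sum; apply: ler_sum => j _.
rewrite -scalerAl -scalerAr !linearZ /= mulrA -exprD.
apply: le_trans (ler_norm _) _; rewrite normrM ler_piMl //.
by rewrite ger0_norm ?exprn_ge0 // exprn_ile1.
Qed.

Lemma pint_cauchy_schwarz p g : pint (p * g) ^+ 2 <= pint (p ^+ 2) * pint (g ^+ 2).
Proof.
have sq h : 0 <= pint (h ^+ 2).
  by apply: pint_ge0 => s _; rewrite horner_exp sqr_ge0.
have [g0|g0] := eqVneq (pint (g ^+ 2)) 0.
  by rewrite (pint_sqr_eq0 g0) mulr0 linear0 expr0n /= mulr_ge0.
have gp : 0 < pint (g ^+ 2) by rewrite lt0r g0 sq.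
set A := pint (p ^+ 2); set B := pint (p * g); set D := pint (g ^+ 2) in gp *.
have := sq (D *: p - B *: g).
have -> : (D *: p - B *: g) ^+ 2 =
    D ^+ 2 *: p ^+ 2 - (2 * D * B) *: (p * g) + B ^+ 2 *: g ^+ 2.
  by rewrite -!mul_polyC !polyCM; ring.
rewrite -scaleNr !pintD !pintZ -/A -/B -/D => h.
suff : 0 <= D * (A * D - B ^+ 2) by rewrite pmulr_rge0 // subr_ge0.
suff <- : D ^+ 2 * A + - (2 * D * B) * B + B ^+ 2 * D = D * (A * D - B ^+ 2) by [].
by ring.
Qed.

End poly_integral.

(** * Discontinuous Galerkin steps in a semi-inner product space *)

Section semi_inner_product.
Context {R : realType} {E : lmodType R}.

(** Functions are not identified almost everywhere, so the [L^2] product is only semidefinite. It is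
    defined for all functions, but linear only on the square-integrable ones, which [P] singles out;
    symmetry and positivity hold without restriction. *)
Definition semi_inner (P : E -> Prop) (B : E -> E -> R) : Prop :=
  [/\ P 0,
      forall a x y, P x -> P y -> P (a *: x + y),
      forall x y, B x y = B y x,
      forall a x y z, P x -> P y -> P z -> B (a *: x + y) z = a * B x z + B y z &
      forall x, 0 <= B x x].

Context (P : E -> Prop) (B : E -> E -> R).
Hypothesis HB : semi_inner P B.
Implicit Types (x y z : E) (a s : R).

Let P0 : P 0. Proof. by case: HB. Qed.
Let PL a x y : P x -> P y -> P (a *: x + y).
Proof. by case: HB => _ + _ _ _; apply. Qed.
Let BC x y : B x y = B y x. Proof. by case: HB. Qed.
Let BL a x y z : P x -> P y -> P z -> B (a *: x + y) z = a * B x z + B y z.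
Proof. by case: HB => _ _ _ + _; apply. Qed.
Let B0 x : 0 <= B x x. Proof. by case: HB. Qed.

Lemma semi_innerZ a x : P x -> P (a *: x).
Proof. by move=> Px; rewrite -[_ *: _]addr0; exact: PL. Qed.

Lemma semi_innerD x y : P x -> P y -> P (x + y).
Proof. by move=> Px Py; rewrite -[x]scale1r; exact: PL. Qed.

Lemma semi_innerB x y : P x -> P y -> P (x - y).
Proof. by move=> Px Py; rewrite addrC -scaleN1r; exact: PL. Qed.

Lemma semi_inner_sum (I : Type) (r : seq I) (F : I -> E) :
  (forall i, P (F i)) -> P (\sum_(i <- r) F i).
Proof.
move=> PF; elim: r => [|i r ih]; first by rewrite big_nil.
by rewrite big_cons; exact: semi_innerD.
Qed.

Lemma semi_inner0l z : P z -> B 0 z = 0.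
Proof.
move=> Pz; have := @BL 1 0 0 z P0 P0 Pz; rewrite scaler0 addr0 mul1r => /eqP.
by rewrite addrC -subr_eq subrr => /eqP.
Qed.

Lemma semi_innerBl x y z : P x -> P y -> P z -> B (x - y) z = B x z - B y z.
Proof. by move=> *; rewrite addrC -scaleN1r BL // mulN1r addrC. Qed.

Lemma semi_inner_suml (I : Type) (r : seq I) (F : I -> E) (a : I -> R) z :
  (forall i, P (F i)) -> P z ->
  B (\sum_(i <- r) a i *: F i) z = \sum_(i <- r) a i * B (F i) z.
Proof.
move=> PF Pz; elim: r => [|i r ih]; first by rewrite !big_nil semi_inner0l.
rewrite !big_cons BL ?ih //.
by apply: semi_inner_sum => j; exact: semi_innerZ.
Qed.

Lemma semi_inner_sumr (I : Type) (r : seq I) (F : I -> E) (a : I -> R) z :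
  (forall i, P (F i)) -> P z ->
  B z (\sum_(i <- r) a i *: F i) = \sum_(i <- r) a i * B z (F i).
Proof.
move=> PF Pz; rewrite BC semi_inner_suml //.
by apply: eq_bigr => i _; rewrite BC.
Qed.

Lemma semi_inner_cauchy x y : P x -> P y -> B x y ^+ 2 <= B x x * B y y.
Proof.
move=> Px Py.
have key t : 0 <= t ^+ 2 * B x x + 2 * t * B x y + B y y.
  have Pz : P (t *: x + y) by exact: PL.
  have := B0 (t *: x + y).
  rewrite BL // (BC x) (BC y (_ + _)) !BL // (BC y x) => h.
  by apply: le_trans h _; rewrite le_eqVlt; apply/orP; left; apply/eqP; ring.
have [x0|x0] := eqVneq (B x x) 0.
  have [->|xy0] := eqVneq (B x y) 0; first by rewrite expr0n /= mulr_ge0.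
  (* With [B x x = 0] the expression in [key] is affine in [t]; this [t] gives it the value -1. *)
  have := key (- (B y y + 1) / (2 * B x y)).
  rewrite x0 mulr0 add0r (_ : 2 * _ * B x y = - (B y y + 1)); last by field.
  by rewrite opprD addrAC addNr add0r oppr_ge0 ler10.
have xp : 0 < B x x by rewrite lt0r x0 B0.
(* The minimizer of the quadratic in [key]. *)
have := key (- B x y / B x x).
rewrite (_ : _ + _ = (B x x * B y y - B x y ^+ 2) / B x x); last by field.
by rewrite pmulr_lge0 ?invr_gt0 // subr_ge0.
Qed.

Lemma semi_inner_cauchy_sqrt x y : P x -> P y ->
  `|B x y| <= Num.sqrt (B x x) * Num.sqrt (B y y).
Proof.
by move=> Px Py; rewrite -sqrtrM // -sqrtr_sqr ler_wsqrtr // semi_inner_cauchy.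
Qed.

Lemma semi_inner_minkowski a x y : P x -> P y ->
  Num.sqrt (B (a *: x + y) (a *: x + y)) <=
  `|a| * Num.sqrt (B x x) + Num.sqrt (B y y).
Proof.
move=> Px Py; have Pz : P (a *: x + y) by exact: PL.
have r0 : 0 <= `|a| * Num.sqrt (B x x) + Num.sqrt (B y y).
  by rewrite addr_ge0 ?mulr_ge0 ?sqrtr_ge0.
rewrite -[leRHS]ger0_norm // -sqrtr_sqr ler_wsqrtr //.
rewrite sqrrD exprMn !sqr_sqrtr // BL // (BC x) (BC y (_ + _)) !BL // (BC y x).
rewrite real_normK ?num_real //.
have h := semi_inner_cauchy_sqrt Px Py.
have : a * B x y <= `|a| * (Num.sqrt (B x x) * Num.sqrt (B y y)).
  by apply: le_trans (ler_norm _) _; rewrite normrM ler_wpM2l.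
by rewrite mulrA; lra.
Qed.

(** * Polynomial curves over the unit time interval *)

Section slab.
Context (q : nat) (U : 'I_q.+1 -> E).
Hypothesis PU : forall j, P (U j).
Implicit Types c d : 'I_q.+1 -> {poly R}.

(** One family [U] of coefficients serves for the solution, its derivative and both test functions;
    these differ only in the scalar polynomials [c]. *)
Definition curve c s : E := \sum_j (c j).[s] *: U j.

Definition curve_inner c d : {poly R} :=
  \sum_i \sum_j B (U i) (U j) *: (c i * d j).

Definition monomials (j : 'I_q.+1) : {poly R} := 'X^j.

Definition dmonomials (j : 'I_q.+1) : {poly R} := ('X^j)^`().

(** Projection in time is linear, so it acts on the monomials one by one and leaves the coefficients
    [U] untouched. *)
Definition weighted (j : 'I_q.+1) : {poly R} := proj q ('X * 'X^j).

Lemma curve_in c s : P (curve c s).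
Proof. by apply: semi_inner_sum => j; exact: semi_innerZ. Qed.

Lemma curve_innerE c d s : (curve_inner c d).[s] = B (curve c s) (curve d s).
Proof.
rewrite semi_inner_suml //; last exact: curve_in.
rewrite horner_sum; apply: eq_bigr => i _; rewrite semi_inner_sumr //.
rewrite horner_sum mulr_sumr; apply: eq_bigr => j _.
by rewrite hornerZ hornerM; ring.
Qed.

Lemma curve_innerC c d : curve_inner c d = curve_inner d c.
Proof.
rewrite /curve_inner exchange_big; apply: eq_bigr => i _.
by apply: eq_bigr => j _; rewrite BC mulrC.
Qed.

Lemma deriv_energy :
  (curve_inner monomials monomials)^`() = 2 *: curve_inner dmonomials monomials.
Proof.
rewrite scaler_nat mulr2n [X in _ + X]curve_innerC -big_split [LHS]linear_sum /=.
apply: eq_bigr => i _.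
rewrite -big_split [LHS]linear_sum /=; apply: eq_bigr => j _.
by rewrite derivZ derivM scalerDr.
Qed.

Let Q := pint (curve_inner monomials monomials).

Lemma pint_energy_rate :
  2 * pint (curve_inner dmonomials monomials) =
  B (curve monomials 1) (curve monomials 1)
  - B (curve monomials 0) (curve monomials 0).
Proof. by rewrite -pintZ -deriv_energy pint_deriv !curve_innerE. Qed.

(* Testing with the projection of [s * Y(s)] turns the energy rate into a mean:
   [int s (|Y|^2)' = |Y(1)|^2 - int |Y|^2]. *)
Lemma pint_weighted_rate :
  2 * pint (curve_inner dmonomials weighted) =
  B (curve monomials 1) (curve monomials 1) - Q.
Proof.
have -> : pint (curve_inner dmonomials weighted) =
    pint ('X * curve_inner dmonomials monomials).
  rewrite /curve_inner mulr_sumr !linear_sum; apply: eq_bigr => i _.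
  rewrite mulr_sumr !linear_sum; apply: eq_bigr => j _.
  rewrite -scalerAr /= !pintZ pint_proj; first by rewrite mulrCA.
  rewrite /dmonomials derivXn -scaler_nat (leq_trans (size_scale_leq _ _)) //.
  by rewrite size_polyXn; have := ltn_ord i; lia.
rewrite -pintZ scalerAr -deriv_energy.
set G := curve_inner monomials monomials.
have -> : 'X * G^`() = ('X * G)^`() + (-1) *: G.
  by rewrite derivM derivX mul1r scaleN1r addrAC subrr add0r.
rewrite pintD pintZ pint_deriv !hornerM !hornerX mul0r subr0 mul1r mulN1r.
by rewrite curve_innerE.
Qed.

Lemma curve_mean_ge0 : 0 <= Q.
Proof. by apply: pint_ge0 => s _; rewrite curve_innerE. Qed.

(** Pairing the curve with its own value [z] at [s] reduces the claim to the scalar polynomial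
    [b = B (Y(.)) z]: [B z z] is the integral of [b * m], and the integral of [b ^+ 2] is at most
    [B z z * Q]. Cauchy-Schwarz and division by [B z z] finish. Hence [K] depends on polynomials in
    time only. *)
Lemma curve_bound_riesz c s (m : {poly R}) (K : R) : 0 <= K ->
  (forall j, (c j).[s] = pint ('X^j * m)) -> pint (m ^+ 2) <= K ->
  B (curve c s) (curve c s) <= K * Q.
Proof.
move=> K0 cm mK; set z := curve c s.
have Pz : P z by exact: curve_in.
pose b : {poly R} := \sum_j B (U j) z *: 'X^j.
have bE r : b.[r] = B (curve monomials r) z.
  rewrite semi_inner_suml // horner_sum; apply: eq_bigr => j _.
  by rewrite hornerZ mulrC.
have zE : B z z = pint (b * m).
  rewrite {1}/z semi_inner_suml // mulr_suml linear_sum; apply: eq_bigr => j _.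
  by rewrite -scalerAl /= pintZ cm mulrC.
have bQ : pint (b ^+ 2) <= B z z * Q.
  rewrite -subr_ge0 -pintZ -[X in _ - X]mul1r -mulNr -pintZ -pintD.
  apply: pint_ge0 => r _; rewrite hornerD !hornerZ mulN1r subr_ge0 horner_exp bE.
  by rewrite curve_innerE mulrC semi_inner_cauchy //; exact: curve_in.
have := pint_cauchy_schwarz b m; rewrite -zE => h.
have m0 : 0 <= pint (m ^+ 2).
  by apply: pint_ge0 => r _; rewrite horner_exp sqr_ge0.
have b0 : 0 <= pint (b ^+ 2).
  by apply: pint_ge0 => r _; rewrite horner_exp sqr_ge0.
have Q0 := curve_mean_ge0.
have [->|z0] := eqVneq (B z z) 0; first by rewrite mulr_ge0.
have zp : 0 < B z z by rewrite lt0r z0 B0.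
rewrite -(ler_pM2l zp) -expr2; apply: le_trans h _.
apply: le_trans (ler_pM b0 m0 bQ mK) _.
by rewrite mulrAC mulrA.
Qed.

Lemma curve_bound s : 0 <= s <= 1 ->
  B (curve monomials s) (curve monomials s) <= rkernel_bound q * Q.
Proof.
move=> s01; apply: (@curve_bound_riesz _ _ (rkernel q s)).
- by exact: le_trans ler01 (rkernel_bound_ge1 q).
- by move=> j; rewrite rkernelP // size_polyXn; exact: ltn_ord.
- exact: pint_rkernel_sqr.
Qed.

(** Moving the projection onto the kernel, the value of [proj q ('X * 'X^j)] at [s] is the moment of
    ['X * rkernel q s] against ['X^j]. The extra factor ['X] is at most 1 on the interval, so the
    constant of [curve_bound] persists. *)
Lemma weighted_bound s : 0 <= s <= 1 ->
  B (curve weighted s) (curve weighted s) <= rkernel_bound q * Q.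
Proof.
move=> s01; apply: (@curve_bound_riesz _ _ ('X * rkernel q s)).
- by exact: le_trans ler01 (rkernel_bound_ge1 q).
- move=> j; rewrite -(rkernelP s (size_proj _ _)) mulrC.
  by rewrite pint_proj ?size_rkernel //; congr pint; ring.
- apply: le_trans (pint_rkernel_sqr q s01).
  rewrite -subr_ge0 -[X in _ - X]mul1r -mulNr -pintZ -pintD.
  apply: pint_ge0 => r /andP[r0 r1].
  rewrite hornerD hornerZ !horner_exp hornerM hornerX exprMn.
  rewrite mulN1r -[X in X - _]mul1r -mulrBl mulr_ge0 ?sqr_ge0 //.
  by rewrite subr_ge0 exprn_ile1.
Qed.

Definition curve_size : R := Num.sqrt (rkernel_bound q * Q).

Lemma slab_bounds (z0 : E) (L1 L2 D : R) :
  let J := curve monomials 0 - z0 in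
  let j := Num.sqrt (B J J) in
  let e1 := B (curve monomials 1) (curve monomials 1) in
  P z0 ->
  pint (curve_inner dmonomials monomials) + B J (curve monomials 0) = L1 ->
  pint (curve_inner dmonomials weighted) + B J (curve weighted 0) = L2 ->
  L1 <= curve_size * D -> `|L2| <= curve_size * D ->
  e1 + j ^+ 2 <= B z0 z0 + 2 * (curve_size * D) /\
  curve_size ^+ 2 <= rkernel_bound q *
     (e1 + 2 * (j * curve_size) + 2 * (curve_size * D)).
Proof.
move=> J j e1 Pz0 H1 H2 HL1 HL2.
have K0 : 0 <= rkernel_bound q :> R by exact: le_trans ler01 (rkernel_bound_ge1 q).
have PY : P (curve monomials 0) by exact: curve_in.
have PJ : P J by exact: semi_innerB.
split.
  rewrite /j sqr_sqrtr //.
  (* Together with [JY] this gives [2 B(J, Y(0)) = |Y(0)|^2 + |J|^2 - |z0|^2]; the term [|Y(0)|^2]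
     then cancels against [pint_energy_rate]. *)
  have JE : B J J = B (curve monomials 0) (curve monomials 0)
     - 2 * B z0 (curve monomials 0) + B z0 z0.
    rewrite /J semi_innerBl // BC semi_innerBl // (BC z0 (_ - _)) semi_innerBl //.
    by rewrite (BC (curve _ _) z0); ring.
  have JY : B J (curve monomials 0) =
      B (curve monomials 0) (curve monomials 0) - B z0 (curve monomials 0).
    by rewrite /J semi_innerBl.
  have := pint_energy_rate; rewrite -/e1.
  by move: H1 HL1; rewrite JE JY; lra.
rewrite /curve_size sqr_sqrtr ?mulr_ge0 ?curve_mean_ge0 // -/curve_size.
apply: ler_wpM2l => //.
(* The function [s Y(s)] vanishes at 0, but its projection need not, so the jump survives here. *)
have BW : `|B J (curve weighted 0)| <= j * curve_size.
  apply: le_trans (semi_inner_cauchy_sqrt PJ (curve_in _ _)) _.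
  rewrite ler_wpM2l ?sqrtr_ge0 // ler_wsqrtr // weighted_bound //.
  by rewrite lexx ler01.
have := pint_weighted_rate; rewrite -/e1.
by move: H2 HL2 BW; rewrite !ler_norml => <- /andP[] + + /andP[]; lra.
Qed.

End slab.
End semi_inner_product.

(** * The recursion over the slabs and its absorption *)

Lemma exists_argmax (R : realType) (N : nat) (y : nat -> R) : (0 < N)%N ->
  exists2 m, (m < N)%N & forall n, (n < N)%N -> y n <= y m.
Proof.
elim: N => // -[|N] ih _; first by exists 0%N => // -[].
have [m mN mm] := ih isT.
have [le|lt] := leP (y m) (y N.+1).
  exists N.+1 => // n; rewrite ltnS leq_eqVlt => /predU1P[-> //|hn].
  exact: le_trans (mm _ hn) le.
exists m; first exact: ltnW.
by move=> n; rewrite ltnS leq_eqVlt => /predU1P[->|]; [exact: ltW|exact: mm].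
Qed.

Lemma dg_recursion (R : realType) (K : R) (N : nat) (e j y D : nat -> R) (Dt : R) :
  1 <= K ->
  (forall n, (n < N)%N -> 0 <= e n.+1) ->
  (forall n, (n < N)%N -> 0 <= y n) ->
  (forall n, (n < N)%N -> 0 <= D n) ->
  \sum_(n < N) D n <= Dt ->
  (forall n, (n < N)%N -> e n.+1 + j n ^+ 2 <= e n + 2 * (y n * D n)) ->
  (forall n, (n < N)%N ->
     y n ^+ 2 <= K * (e n.+1 + 2 * (j n * y n) + 2 * (y n * D n))) ->
  forall n, (n < N)%N ->
    y n ^+ 2 <= 2 * (2 * K + 4 * K ^+ 2) * e 0%N
                + (8 * K + 8 * K ^+ 2) ^+ 2 * Dt ^+ 2.
Proof.
move=> K1 He Hy HD HDt H1 H2 n nN.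
have [m mN mmax] := exists_argmax y (leq_ltn_trans (leq0n n) nN).
set Y := y m; have Y0 : 0 <= Y by exact: Hy.
apply: (@le_trans _ _ (Y ^+ 2)).
  by rewrite ler_sqr ?nnegrE ?Hy // mmax.
have S0 k : (k <= N)%N -> \sum_(i < k) D i <= Dt.
  move=> kN; apply: le_trans HDt.
  rewrite (big_ord_widen _ D kN) big_mkcond /=; apply: ler_sum => i _.
  by case: ifP => // _; exact: HD.
have Dn0 k : (k < N)%N -> D k <= Dt.
  move=> kN; apply: le_trans (S0 _ kN); rewrite big_ord_recr /= lerDr.
  by apply: sumr_ge0 => i _; apply: HD; exact: ltn_trans kN.
have eS k : (k <= N)%N -> e k <= e 0%N + 2 * Y * \sum_(i < k) D i.
  elim: k => [|k ih] kN; first by rewrite big_ord0 mulr0 addr0.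
  have := ih (ltnW kN); rewrite big_ord_recr /= => h1; have h2 := H1 k kN.
  have h3 : y k * D k <= Y * D k by rewrite ler_wpM2r ?HD // mmax.
  by have := sqr_ge0 (j k); lra.
have eb k : (k <= N)%N -> e k <= e 0%N + 2 * (Y * Dt).
  move=> kN; apply: le_trans (eS k kN) _; rewrite lerD2l -mulrA ler_pM2l //.
  by rewrite ler_wpM2l // S0.
(* Dropping [e m.+1 >= 0] in step [m]. The sum in [eS m] stops before [D m], which step [m] itself
   supplies, so both together stay below [Dt]. *)
have jb : j m ^+ 2 <= e 0%N + 2 * (Y * Dt).
  have h2 := H1 m mN; have h1 := eS m (ltnW mN); have h3 := He m mN.
  have := S0 _ mN; rewrite big_ord_recr /= => h4.
  have h5 := ler_wpM2l Y0 h4; rewrite mulrDr in h5.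
  by rewrite -/Y in h2; lra.
have yD : Y * D m <= Y * Dt by rewrite ler_wpM2l // Dn0.
have em := eb _ mN; have Hm := H2 m mN; rewrite -/Y in Hm.
(* Young: [2 K j Y <= 2 K^2 j^2 + Y^2 / 2]. *)
have young1 : 2 * K * (j m * Y) <= 2 * K ^+ 2 * j m ^+ 2 + Y ^+ 2 / 2.
  rewrite -subr_ge0 (_ : _ - _ = (2 * K * j m - Y) ^+ 2 / 2); last by field.
  by rewrite divr_ge0 // sqr_ge0.
have K0 : 0 <= K by apply: le_trans K1.
have Kj : 2 * K ^+ 2 * j m ^+ 2 <= 2 * K ^+ 2 * (e 0%N + 2 * (Y * Dt)).
  by rewrite ler_wpM2l // mulr_ge0 ?sqr_ge0.
have Ke := ler_wpM2l K0 em; have KD := ler_wpM2l K0 yD.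
(* Once half of [Y ^+ 2] is absorbed, [Y ^+ 2 <= (2 K + 4 K ^+ 2) e 0 + M Y Dt]. A second use of
   Young's inequality absorbs [M Y Dt] and doubles the factor of [e 0]. *)
set M := 8 * K + 8 * K ^+ 2.
have young2 : M * (Y * Dt) <= Y ^+ 2 / 2 + M ^+ 2 * Dt ^+ 2 / 2.
  rewrite -subr_ge0 (_ : _ - _ = (Y - M * Dt) ^+ 2 / 2); last by field.
  by rewrite divr_ge0 // sqr_ge0.
rewrite {1}/M in young2.
by rewrite !mulrDr in Hm Ke Kj *; lra.
Qed.

(** * Integrals without measurability *)

(** Unless [S] is infinite, it bounds both suprema, which are nonnegative because both sets contain
    0; being finite, they can be moved across the inequality one at a time. *)
Lemma ereal_sup_addle (R : realType) (X Y : set (\bar R)) (S : \bar R) :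
  X 0%E -> Y 0%E -> (forall y, Y y -> (0 <= y)%E) ->
  (forall x y, X x -> Y y -> (x + y <= S)%E) ->
  (ereal_sup X + ereal_sup Y <= S)%E.
Proof.
move=> X0 Y0 Yge0 XY.
have S0 : (0 <= S)%E by rewrite -(adde0 0%E) XY.
have supX0 : (0 <= ereal_sup X)%E by exact: ereal_sup_ubound.
have supXS : (ereal_sup X <= S)%E.
  by apply: ge_ereal_sup => x Xx; rewrite -(adde0 x) XY.
case: S S0 supXS XY => [s| |] // s0 supXS XY; last by rewrite leey.
have fX : ereal_sup X \is a fin_num.
  by rewrite ge0_fin_numE // (le_lt_trans supXS) // ltry.
rewrite addeC -leeBrDr //; apply: ge_ereal_sup => y Yy.
have fy : y \is a fin_num.
  by rewrite ge0_fin_numE ?Yge0 // (@le_lt_trans _ _ s%:E) ?ltry // -(add0e y) XY.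
rewrite leeBrDr // addeC -leeBrDr //; apply: ge_ereal_sup => x Xx.
by rewrite leeBrDr // XY.
Qed.

(* For nonnegative functions [integral] is the supremum over the simple functions
   below, whether or not the integrand is measurable: it is monotone,
   superadditive over disjoint sets and subhomogeneous without any
   measurability in time of the norms of the data. *)
Section lower_integral.
Import HBNNSimple.
Context d (T : measurableType d) (R : realType).
Variable mu : {measure set T -> \bar R}.
Local Open Scope ereal_scope.
Implicit Types (D A B : set T) (f g : T -> \bar R).

Lemma ge0_le_lower_integral D f g : (forall x, D x -> 0 <= f x) ->
  (forall x, D x -> f x <= g x) ->
  \int[mu]_(x in D) f x <= \int[mu]_(x in D) g x.
Proof.
move=> f0 fg.
rewrite ge0_integralE // ge0_integralE; last first.
  by move=> x Dx; exact: le_trans (f0 _ Dx) (fg _ Dx).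
apply: le_ereal_sup => _ [h /= hf <-]; exists h => //= x.
apply: le_trans (hf x) _; rewrite /patch; case: ifPn => // /set_mem Dx.
exact: fg.
Qed.

Lemma ge0_lower_integralZ_le D f (a : R) : (0 < a)%R ->
  (forall x, D x -> 0 <= f x) ->
  \int[mu]_(x in D) (a%:E * f x) <= a%:E * \int[mu]_(x in D) f x.
Proof.
move=> a0 f0.
rewrite ge0_integralE; last by move=> x Dx; rewrite mule_ge0 ?f0 // lee_fin ltW.
rewrite [in leRHS]ge0_integralE //.
apply: ge_ereal_sup => _ [h /= hf <-].
have ai0 : (0 <= a^-1)%R by rewrite invr_ge0 ltW.
pose k : {nnsfun T >-> R} := scale_nnsfun h ai0.
have kE : sintegral mu h = a%:E * sintegral mu k.
  rewrite (_ : sintegral mu k = (a^-1)%:E * sintegral mu h); last first.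
    exact: sintegralrM.
  by rewrite muleA -EFinM divff ?gt_eqF // mul1e.
rewrite kE lee_pmul2l ?lte_fin //; apply: ereal_sup_ubound; exists k => //= x.
have := hf x; rewrite /patch; case: ifPn => // _ hx.
  by rewrite EFinM lee_pdivrMl.
by move: hx; rewrite !lee_fin => hx; rewrite mulr_ge0_le0.
Qed.

(** Simple functions below the two restrictions add up to a simple function below [f] on [D]: by
    disjointness at most one of them is nonzero at each point. *)
Lemma ge0_lower_integral_superadd D A B f : (forall x, D x -> 0 <= f x) ->
  A `<=` D -> B `<=` D -> A `&` B = set0 ->
  \int[mu]_(x in A) f x + \int[mu]_(x in B) f x <= \int[mu]_(x in D) f x.
Proof.
move=> f0 AD BD AB.
have fA x : A x -> 0 <= f x by move=> /AD; exact: f0.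
have fB x : B x -> 0 <= f x by move=> /BD; exact: f0.
rewrite (ge0_integralE _ fA) (ge0_integralE _ fB) (ge0_integralE _ f0).
set S := ereal_sup [set _ | h in [set h : {nnsfun T >-> R} |
  forall x, (h x)%:E <= (f \_ D) x]].
have key (h k : {nnsfun T >-> R}) : (forall x, (h x)%:E <= (f \_ A) x) ->
    (forall x, (k x)%:E <= (f \_ B) x) -> sintegral mu h + sintegral mu k <= S.
  move=> hA kB; rewrite -sintegralD.
  apply: ereal_sup_ubound; exists (add_nnsfun h k) => //= x.
  have := hA x; have := kB x; rewrite /patch.
  have h0 : (0 <= h x)%R by [].
  have k0 : (0 <= k x)%R by [].
  case: (boolP (x \in A)) => xA; case: (boolP (x \in B)) => xB.
  - by have : (A `&` B) x by [split; exact: set_mem]; rewrite AB.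
  - have -> : x \in D by apply/mem_set/AD/set_mem.
    rewrite lee_fin => k0' hx; rewrite (_ : k x = 0%R) ?addr0 //.
    exact/le_anti/andP.
  - have -> : x \in D by apply/mem_set/BD/set_mem.
    rewrite lee_fin => hx h0'; rewrite (_ : h x = 0%R) ?add0r //.
    by apply/le_anti/andP; rewrite -?lee_fin.
  - rewrite !lee_fin => k0' h0'; have -> : (h x + k x = 0)%R.
      by apply/le_anti/andP; split; rewrite ?addr_ge0 ?addr_le0 //; lra.
    by case: ifPn => // /set_mem xD; exact: f0.
apply: ereal_sup_addle.
- by exists nnsfun0 => [x /=|]; [rewrite erestrict_ge0|exact: sintegral0].
- by exists nnsfun0 => [x /=|]; [rewrite erestrict_ge0|exact: sintegral0].
- by move=> _ [h _ <-]; exact: sintegral_ge0.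
- by move=> _ _ [h hA <-] [k kB <-]; exact: key.
Qed.

(** [Rintegral] is the difference of the integrals of the positive and negative parts. Both lie
    between 0 and the lower integral of the absolute value, and so does the absolute value of their
    difference. *)
Lemma normr_Rintegral_le_lower D (h : T -> R) g (y : R) :
  (0 <= y)%R -> (forall x, D x -> 0 <= g x) ->
  (forall x, D x -> `|h x|%:E <= y%:E * g x) ->
  \int[mu]_(x in D) g x < +oo ->
  (`|Rintegral mu D h| <= y * fine (\int[mu]_(x in D) g x))%R.
Proof.
move=> y0 g0 hg goo.
have gfin : \int[mu]_(x in D) g x \is a fin_num.
  by rewrite ge0_fin_numE // integral_ge0.
have key : \int[mu]_(x in D) (`|h x|)%:E <= y%:E * \int[mu]_(x in D) g x.
  (* The scaling lemma requires a positive factor. For [y = 0] the function [h] vanishes on [D],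
     even where [g] is infinite, since [0 * +oo = 0]. *)
  move: y0; rewrite le_eqVlt => /predU1P[y0|y0].
    rewrite -y0 mul0e integral0_eq // => x Dx; apply/le_anti/andP; split.
      by have := hg x Dx; rewrite -y0 mul0e.
    by rewrite lee_fin.
  apply: le_trans (ge0_lower_integralZ_le y0 g0).
  by apply: ge0_le_lower_integral => // x _; rewrite lee_fin.
rewrite -lee_fin EFinM fineK //; apply: le_trans (key).
have Mfin : \int[mu]_(x in D) (`|h x|)%:E \is a fin_num.
  rewrite ge0_fin_numE; last by apply: integral_ge0 => x _; rewrite lee_fin.
  by rewrite (le_lt_trans key) // -(fineK gfin) -EFinM ltry.
rewrite /Rintegral integralE.
have p0 : 0 <= \int[mu]_(x in D) (fun t => (h t)%:E)^\+ x by exact: integral_ge0.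
have n0 : 0 <= \int[mu]_(x in D) (fun t => (h t)%:E)^\- x by exact: integral_ge0.
have pM : \int[mu]_(x in D) (fun t => (h t)%:E)^\+ x
    <= \int[mu]_(x in D) (`|h x|)%:E.
  apply: ge0_le_lower_integral => // x _.
  by rewrite funeposE -EFin_max lee_fin ge_max ler_norm normr_ge0.
have nM : \int[mu]_(x in D) (fun t => (h t)%:E)^\- x
    <= \int[mu]_(x in D) (`|h x|)%:E.
  apply: ge0_le_lower_integral => // x _.
  by rewrite funenegE -EFin_max lee_fin ge_max -normrN ler_norm normr_ge0.
move: p0 n0 pM nM Mfin.
case: (\int[mu]_(x in D) (fun t => (h t)%:E)^\+ x) => [p| |] //;
case: (\int[mu]_(x in D) (fun t => (h t)%:E)^\- x) => [n| |] //;
case: (\int[mu]_(x in D) (`|h x|)%:E) => [M| |] //=; rewrite ?lee_fin //.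
by move=> p0 n0 pM nM _; rewrite ler_norml; apply/andP; split; lra.
Qed.

End lower_integral.
(** * Square-integrable functions and Sobolev spaces *)

Section rV_measure.
Context {R : realType}.

Definition cube d (c : 'rV[R]_d) (r : R) : set 'rV[R]_d :=
  [set x | forall i, `|c ord0 i - x ord0 i| < r].

Lemma measurable_cube d (c : 'rV[R]_d) (r : R) : measurable (cube c r).
Proof.
have -> : cube c r = \bigcap_(i in [set: 'I_d])
    ((fun x : 'rV[R]_d => x ord0 i) @^-1` `]c ord0 i - r, c ord0 i + r[).
  apply/seteqP; split => x /= cx i.
    move=> _; have := cx i; rewrite ltr_norml /= in_itv /= => /andP[h1 h2].
    by apply/andP; split; lra.
  have := cx i Logic.I; rewrite /= in_itv /= => /andP[h1 h2].
  by rewrite ltr_norml; apply/andP; split; lra.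
apply: fin_bigcap_measurable => // i _.
by rewrite -[X in measurable X]setTI; exact: measurable_coord.
Qed.

(** The sigma-algebra is generated by the coordinates, so an open set has to be exhausted by
    countably many cubes with rational centres. *)
Lemma open_measurable_rV d (A : set 'rV[R]_d) : open A -> measurable A.
Proof.
move=> oA.
pose cr (p : 'rV[rat]_d * nat) : 'rV[R]_d := map_mx ratr p.1.
pose I := [set p : 'rV[rat]_d * nat | cube (cr p) (p.2.+1%:R^-1) `<=` A].
have -> : A = \bigcup_(p in I) cube (cr p) (p.2.+1%:R^-1).
  apply/seteqP; split => [x Ax|x [p Ip]]; last exact: Ip.
  have /nbhs_ballP[e /= e0 eA] : nbhs x A by exact: open_nbhs_nbhs.
  (* Half of [e], because a cube is centred at a rational point near [x] and not at [x]: its points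
     are within twice its radius from [x]. *)
  have [k _ ke] : \forall k \near \oo, k.+1%:R^-1 < e / 2.
    exact: (near_infty_natSinv_lt (PosNum (divr_gt0 e0 (ltr0n _ 2)))).
  have {}ke := ke k (leqnn k).
  have k0 : (0 : R) < k.+1%:R^-1 by rewrite invr_gt0 ltr0n.
  move: ke k0; set r : R := k.+1%:R^-1 => ke k0.
  have qE (i : 'I_d) : exists q : rat, `|x ord0 i - ratr q| < r.
    have [|q] := @rat_in_itvoo R (x ord0 i - r) (x ord0 i + r).
      by lra.
    rewrite in_itv /= => /andP[q1 q2]; exists q.
    by rewrite ltr_norml; apply/andP; split; lra.
  pose c := \row_i projT1 (cid (qE i)).
  have cP i : `|x ord0 i - ratr (c ord0 i)| < r.
    by rewrite mxE; exact: projT2 (cid (qE i)).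
  have cx : cube (cr (c, k)) r x.
    by move=> i; rewrite /= /cr [X in X - _]mxE distrC cP.
  exists (c, k) => // y cy; apply: eA; split => // i j.
  rewrite (ord1 i) /ball /=.
  have := cy j; have := cx j; rewrite distrC /= => h1 h2.
  apply: le_lt_trans (ler_distD (cr (c, k) ord0 j) _ _) _.
  by rewrite [e]splitr; apply: ltrD; [exact: lt_trans h1 ke|exact: lt_trans h2 ke].
rewrite bigcup_mkcond; apply: countable_bigcupT_measurable => [|p].
  exact: countableP.
by case: ifP => // _; exact: measurable_cube.
Qed.

Lemma measurable_box d (M : R) :
  measurable [set x : 'rV[R]_d | forall i, `|x ord0 i| <= M].
Proof.
have -> : [set x : 'rV[R]_d | forall i, `|x ord0 i| <= M] =
    \bigcap_(i in [set: 'I_d]) ((fun x : 'rV[R]_d => x ord0 i) @^-1` `[- M, M]).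
  apply/seteqP; split => x /= h i => [_|].
    by rewrite /= in_itv /= -ler_norml.
  by have := h i Logic.I; rewrite /= in_itv /= -ler_norml.
apply: fin_bigcap_measurable => // i _.
by rewrite -[X in measurable X]setTI; exact: measurable_coord.
Qed.

Lemma lebesgue_rV_box_lty d (M : R) :
  (lebesgue_rV d [set x : 'rV[R]_d | forall i, (`|x ord0 i| <= M)%R] < +oo)%E.
Proof.
elim: d => [|d ih].
  by rewrite /= diracE; case: (_ \in _); rewrite ltry.
rewrite /= /lebesgue_rV_succ /pushforward.
have mB := @measurable_box d M.
have -> : @rV_cons R d @^-1` [set x | forall i, `|x ord0 i| <= M] =
    (`[- M, M]%classic : set (measurableTypeR R))
    `*` [set x : 'rV[R]_d | forall i, `|x ord0 i| <= M].
  apply/seteqP; split => -[a x] /=.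
    move=> h; split => [|i].
      have := h (@lshift 1 d ord0).
      rewrite /rV_cons (@row_mxEl R 1 1 d) mxE eqxx mulr1n.
      by rewrite in_itv /= ler_norml.
    by have := h (@rshift 1 d i); rewrite /rV_cons (@row_mxEr R 1 1 d).
  move=> [ha hx] i; rewrite /rV_cons; case: (@split_ordP 1 d i) => j ->.
    rewrite (@row_mxEl R 1 1 d) mxE (ord1 j) eqxx mulr1n ler_norml.
    by rewrite /= in_itv in ha.
  by rewrite (@row_mxEr R 1 1 d).
rewrite product_measure1E //.
apply: lte_mul_pinfty => //; rewrite /= lebesgue_measure_itv /=.
by case: ifP => _; rewrite ?ltry // -?EFinB ?ltry.
Qed.

Lemma continuous_measurable_rV d (f : 'rV[R]_d -> R) (D : set 'rV[R]_d) :
  continuous f -> measurable_fun D f.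
Proof.
move=> cf; apply/measurable_funTS.
apply: (measurability (@RGenOInfty.G R)); first exact: RGenOInfty.measurableE.
move=> _ [_ [x ->] <-]; rewrite setTI.
apply: open_measurable_rV; apply: open_comp; last exact: interval_open.
by move=> y _; exact: cf.
Qed.

End rV_measure.

(** * The inner products of scalar and vector fields *)

Section L2_space.
Context {R : realType} {d : nat}.
Local Notation X := 'rV[R]_d.
Local Notation mu := (@lebesgue_rV R d).
Context (Om : set X) (mOm : measurable Om).
Implicit Types (u v w : X -> R) (g h k : X -> X) (a b : R).

Lemma L2_sqr_integrable u : L2 Om u ->
  mu.-integrable Om (EFin \o (fun x => u x ^+ 2)).
Proof.
move=> [mu_ uoo]; apply/integrableP; split.
  by apply/measurable_EFinP; apply: measurable_funX.
by under eq_integral do rewrite /= ger0_norm ?sqr_ge0 //.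
Qed.

Lemma L2_mul_integrable u v : L2 Om u -> L2 Om v ->
  mu.-integrable Om (EFin \o (fun x => smul (u x) (v x))).
Proof.
move=> Lu Lv.
have i2 := integrableD mOm (L2_sqr_integrable Lu) (L2_sqr_integrable Lv).
apply: le_integrable i2 => //.
  by apply/measurable_EFinP; apply: measurable_funM; [case: Lu|case: Lv].
move=> x _ /=; rewrite lee_fin /smul normrM.
rewrite [leRHS]ger0_norm ?addr_ge0 ?sqr_ge0 //.
rewrite -(real_normK (num_real (u x))) -(real_normK (num_real (v x))).
move: (`|u x| : R) (`|v x| : R) => a b.
have := sqr_ge0 (a - b); have := sqr_ge0 a; have := sqr_ge0 b.
by rewrite sqrrB; lra.
Qed.

Lemma L2_linear a u v : L2 Om u -> L2 Om v -> L2 Om (a *: u + v).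
Proof.
move=> Lu Lv; have [mu_ uoo] := Lu; have [mv voo] := Lv; split.
  by apply: measurable_funD => //; exact: measurable_funM.
have i2 := integrableD mOm (integrableZl mOm (2 * a ^+ 2) (L2_sqr_integrable Lu))
   (integrableZl mOm 2 (L2_sqr_integrable Lv)).
have i2oo : (\int[mu]_(x in Om) (2 * a ^+ 2 * u x ^+ 2 + 2 * v x ^+ 2)%:E < +oo)%E.
  exact: integrable_lty i2.
apply: le_lt_trans i2oo.
apply: ge0_le_lower_integral => x _ /=; first by rewrite lee_fin sqr_ge0.
rewrite lee_fin -[(a *: u + v) x]/(a * u x + v x).
by have h := sqr_ge0 (a * u x - v x); nra.
Qed.

Lemma L2_0 : L2 Om 0.
Proof.
split; first exact: measurable_cst.
by under eq_integral do rewrite expr0n /=; rewrite integral0.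
Qed.

Lemma L2vec_linear a g h : L2vec Om g -> L2vec Om h -> L2vec Om (a *: g + h).
Proof.
move=> Lg Lh i; have := L2_linear a (Lg i) (Lh i).
by congr L2; apply/funext => x; rewrite [RHS]mxE [in RHS]mxE.
Qed.

Lemma L2vec_0 : L2vec Om 0.
Proof.
by move=> i; have := L2_0; congr L2; apply/funext => x; rewrite [RHS]mxE.
Qed.

Lemma L2vec_dot_integrable g h : L2vec Om g -> L2vec Om h ->
  mu.-integrable Om (EFin \o (fun x => dot (g x) (h x))).
Proof.
move=> Lg Lh; rewrite /dot.
have -> : EFin \o (fun x => \sum_i g x ord0 i * h x ord0 i) =
    (fun x => \sum_(i <- index_enum 'I_d) (g x ord0 i * h x ord0 i)%:E)%E.
  by apply/funext => x /=; rewrite -sumEFin.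
by apply: integrable_sum => // i _; exact: L2_mul_integrable.
Qed.

Lemma innerL2_lin (V : lmodType R) (ip : V -> V -> R) a (f g h : X -> V) :
  (forall a x y z, ip (a *: x + y) z = a * ip x z + ip y z) ->
  mu.-integrable Om (EFin \o (fun x => ip (f x) (h x))) ->
  mu.-integrable Om (EFin \o (fun x => ip (g x) (h x))) ->
  innerL2 ip Om (a *: f + g) h = a * innerL2 ip Om f h + innerL2 ip Om g h.
Proof.
move=> ipL ifh igh; rewrite /innerL2.
under eq_Rintegral do rewrite -[(a *: f + g) _]/(a *: f _ + g _) ipL.
rewrite RintegralD //; first by rewrite RintegralZl.
exact: (integrableZl mOm a ifh).
Qed.

Lemma smul_lin a (x y z : R) : smul (a *: x + y) z = a * smul x z + smul y z.
Proof. by rewrite /smul mulrDl -[a *: x]/(a * x) mulrA. Qed.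

Lemma dot_lin a (x y z : X) : dot (a *: x + y) z = a * dot x z + dot y z.
Proof.
rewrite /dot mulr_sumr -big_split; apply: eq_bigr => i _.
by rewrite !mxE mulrDl mulrA.
Qed.

Lemma dot_ge0 (x : X) : 0 <= dot x x.
Proof. by apply: sumr_ge0 => i _; rewrite -expr2 sqr_ge0. Qed.

Lemma semi_inner_L2 : semi_inner (L2 Om) (innerL2 smul Om).
Proof.
split.
- exact: L2_0.
- by move=> a u v; exact: L2_linear.
- by move=> u v; apply: eq_Rintegral => x _; rewrite /smul mulrC.
- move=> a u v w Lu Lv Lw; apply: innerL2_lin; first exact: smul_lin.
    exact: L2_mul_integrable.
  exact: L2_mul_integrable.
- by move=> u; apply: Rintegral_ge0 => x _; rewrite /smul -expr2 sqr_ge0.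
Qed.

Lemma semi_inner_L2vec : semi_inner (L2vec Om) (innerL2 dot Om).
Proof.
split.
- exact: L2vec_0.
- by move=> a u v; exact: L2vec_linear.
- move=> u v; apply: eq_Rintegral => x _; apply: eq_bigr => i _.
  by rewrite mulrC.
- move=> a u v w Lu Lv Lw; apply: innerL2_lin; first exact: dot_lin.
    exact: L2vec_dot_integrable.
  exact: L2vec_dot_integrable.
- by move=> u; apply: Rintegral_ge0 => x _; exact: dot_ge0.
Qed.

Lemma normL2_ge0 (V : Type) (ip : V -> V -> R) (f : X -> V) :
  (0 <= normL2 ip Om f)%E.
Proof. exact: poweR_ge0. Qed.

Lemma normL2_fin (V : Type) (ip : V -> V -> R) (f : X -> V) :
  (forall x, 0 <= ip x x) ->
  mu.-integrable Om (EFin \o (fun x => ip (f x) (f x))) ->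
  normL2 ip Om f = (Num.sqrt (innerL2 ip Om f f))%:E.
Proof.
move=> ip0 fi; rewrite /normL2 /innerL2 /Rintegral.
have fin : (\int[mu]_(x in Om) (ip (f x) (f x))%:E)%E \is a fin_num.
  exact: integrable_fin_num fi.
rewrite -{1}(fineK fin) poweR_EFin powR12_sqrt //; apply: fine_ge0.
by apply: integral_ge0 => x _; rewrite lee_fin.
Qed.

Lemma normL2_smulE u : L2 Om u ->
  normL2 smul Om u = (Num.sqrt (innerL2 smul Om u u))%:E.
Proof.
move=> Lu; apply: normL2_fin; last exact: L2_mul_integrable.
by move=> x; rewrite /smul -expr2 sqr_ge0.
Qed.

Lemma normL2_dotE g : L2vec Om g ->
  normL2 dot Om g = (Num.sqrt (innerL2 dot Om g g))%:E.
Proof.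
by move=> Lg; apply: normL2_fin; [exact: dot_ge0|exact: L2vec_dot_integrable].
Qed.

(* A measurable [u] may have infinite norm; this only happens on a null set of
   times, but the bound holds for all of them. *)
Lemma cauchy_normL2_smul u v (y : R) : measurable_fun Om u -> L2 Om v ->
  Num.sqrt (innerL2 smul Om v v) <= y ->
  (`|innerL2 smul Om u v|%:E <= y%:E * normL2 smul Om u)%E.
Proof.
move=> mu_ Lv vy; have [uoo|uoo] := ltP (\int[mu]_(x in Om) (u x ^+ 2)%:E)%E +oo%E.
  have Lu : L2 Om u by [].
  rewrite normL2_smulE // -EFinM lee_fin.
  apply: le_trans (semi_inner_cauchy_sqrt semi_inner_L2 Lu Lv) _.
  by rewrite mulrC ler_wpM2r // sqrtr_ge0.
have -> : normL2 smul Om u = +oo%E.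
  rewrite /normL2; have -> : (\int[mu]_(x in Om) (smul (u x) (u x))%:E = +oo)%E.
    by apply/eqP; rewrite -leye_eq.
  by rewrite poweRyr // invr_eq0 pnatr_eq0.
have y0 : 0 <= y by apply: le_trans (sqrtr_ge0 _) vy.
move: y0; rewrite le_eqVlt => /predU1P[y0|y0]; last first.
  by rewrite gt0_muley ?lte_fin // leey.
(* Here the right side is [0 * +oo = 0], so the product must really vanish: [v] has norm 0 and is
   zero almost everywhere. *)
rewrite -y0 mul0e lee_fin normr_le0; apply/eqP.
have v0 : (\int[mu]_(x in Om) `|(v x ^+ 2)%:E| = 0)%E.
  under eq_integral do rewrite abse_EFin ger0_norm ?sqr_ge0 //.
  have := integrable_fin_num mOm (L2_sqr_integrable Lv) => /fineK <-.
  congr EFin; apply/eqP; rewrite eq_le fine_ge0 ?andbT; last first.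
    by apply: integral_ge0 => x _; rewrite lee_fin sqr_ge0.
  rewrite -y0 in vy.
  have : Num.sqrt (innerL2 smul Om v v) == 0 by rewrite eq_le vy sqrtr_ge0.
  by rewrite sqrtr_eq0.
have mv : measurable_fun Om (EFin \o (fun x => v x ^+ 2)).
  by have /integrableP[] := L2_sqr_integrable Lv.
have /(ae_eq_integral_abs _ mOm mv) v0ae := v0.
rewrite /innerL2 /Rintegral (ae_eq_integral (cst 0%E)) ?integral0 //.
- by apply/measurable_EFinP; apply: measurable_funM => //; case: Lv.
- apply: filterS v0ae => x /= h Dx; have := h Dx => -[] /eqP.
  by rewrite sqrf_eq0 => /eqP ->; rewrite /smul mulr0.
Qed.

End L2_space.

(** * Linear structure of the Sobolev and finite element spaces *)

Section sobolev_linear.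
Context {R : realType} {d : nat}.
Local Notation X := 'rV[R]_d.
Local Notation mu := (@lebesgue_rV R d).
Implicit Types (f g phi psi : X -> R) (a : R).

Lemma partial_lin i a f g x :
  derivable f x (delta_mx ord0 i) -> derivable g x (delta_mx ord0 i) ->
  partial i (a *: f + g) x = a * partial i f x + partial i g x.
Proof.
move=> df dg; rewrite /partial deriveD //; first by rewrite deriveZ.
exact: (@derivableZ _ _ _ f a).
Qed.

Lemma Ck_lin k a f g : Ck k f -> Ck k g -> Ck k (a *: f + g).
Proof.
have cl f' g' : continuous f' -> continuous g' -> continuous (a *: f' + g').
  move=> cf cg x.
  have FF : Filter (nbhs x) by exact: (@nbhs_filter X).
  exact: (cvgD (cvgZl_tmp (k := a) (cf x)) (cg x)).
elim: k f g => [|k ih] f g /=; first exact: cl.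
move=> [cf df Cf] [cg dg Cg]; split; first exact: cl.
  move=> x i; apply: derivableD; last exact: dg.
  exact: (@derivableZ _ _ _ f a).
move=> i; have -> : partial i (a *: f + g) = a *: partial i f + partial i g.
  by apply/funext => x; rewrite partial_lin.
exact: ih.
Qed.

Lemma Ck_derivable k f x i : Ck k.+1 f -> derivable f x (delta_mx ord0 i).
Proof. by case. Qed.

Lemma test_function_lin Om a phi psi :
  test_function Om phi -> test_function Om psi ->
  test_function Om (a *: phi + psi).
Proof.
move=> [C1 K1 S1] [C2 K2 S2].
have sub : closure [set x | (a *: phi + psi) x != 0] `<=`
    closure [set x | phi x != 0] `|` closure [set x | psi x != 0].
  rewrite -closureU; apply: closure_subset => x /= h.
  apply: contrapT => /not_orP[/negP]; rewrite negbK => /eqP h1 /negP.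
  rewrite negbK => /eqP h2; move: h; rewrite -[_ x]/(a * phi x + psi x) h1 h2.
  by rewrite mulr0 addr0 eqxx.
split; first by move=> k; exact: Ck_lin.
  by apply: subclosed_compact sub; [exact: closed_closure|exact: compactU].
by move=> x /sub[/S1|/S2].
Qed.

Lemma partial_supp Om i phi x : test_function Om phi ->
  ~ closure [set x | phi x != 0] x -> partial i phi x = 0.
Proof.
move=> tf hx; rewrite /partial (@near_eq_derive _ _ _ phi (cst 0)) ?derive_cst //.
have oC : open (~` closure [set x | phi x != 0]).
  by apply: closed_openC; exact: closed_closure.
have := open_nbhs_nbhs (conj oC hx); apply: filterS => y /= hy.
apply: contrapT => /eqP hy'; apply: hy; exact: subset_closure.
Qed.

Lemma L2_continuous_compact (Om K : set X) f : measurable Om ->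
  continuous f -> compact K -> (forall x, ~ K x -> f x = 0) -> L2 Om f.
Proof.
move=> mOm cf cK f0; split; first exact: continuous_measurable_rV.
have [M [Mr KM]] := compact_bounded cK.
have KM' x : K x -> forall i, `|x ord0 i| <= M + 1.
  move=> Kx i; apply: le_trans (KM (M + 1) _ x Kx); last by rewrite ltrDl.
  rewrite [leRHS]/Num.norm /= mx_normrE.
  by apply: le_trans; last exact: (le_bigmax _ _ (ord0, i)).
have cfK : compact (f @` K).
  by apply: continuous_compact => //; apply: continuous_subspaceT.
have [L [Lr KL]] := compact_bounded cfK.
have fL x : f x ^+ 2 <= (L + 1) ^+ 2.
  have [Kx|/f0 ->] := pselect (K x); last by rewrite expr0n sqr_ge0.
  have : `|f x| <= L + 1 by apply: KL; [rewrite ltrDl|exists x].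
  move=> h; rewrite -(real_normK (num_real (f x))) ler_sqr // nnegrE.
  exact: le_trans h.
set Bx := [set x : X | forall i, `|x ord0 i| <= M + 1].
have mB : measurable Bx by exact: measurable_box.
have : (\int[mu]_(x in Bx) ((L + 1) ^+ 2)%:E < +oo)%E.
  rewrite integral_cst // lte_mul_pinfty ?lee_fin ?sqr_ge0 //.
  exact: lebesgue_rV_box_lty.
apply: le_lt_trans; rewrite integral_mkcond [leRHS]integral_mkcond.
apply: ge0_le_lower_integral => x _.
  by apply: erestrict_ge0 => y _; rewrite lee_fin sqr_ge0.
rewrite /patch; case: (x \in Om); last first.
  by case: ifP => // _; rewrite lee_fin sqr_ge0.
case: ifPn => [_|/negP xB]; first by rewrite lee_fin.
rewrite f0 ?expr0n // => /KM' Kx; apply: xB; exact/mem_set.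
Qed.

(** Makes the integrals in the definition of the weak gradient linear in the Sobolev function. *)
Lemma test_function_L2 Om phi : measurable Om -> test_function Om phi ->
  L2 Om phi /\ forall i, L2 Om (partial i phi).
Proof.
move=> mOm tf; have [C1 K1 S1] := tf; split => [|i].
  apply: (L2_continuous_compact mOm (C1 0%N) K1) => x hx.
  by apply: contrapT => /eqP h; apply: hx; exact: subset_closure.
apply: (L2_continuous_compact mOm _ K1) => [|x]; last exact: partial_supp tf.
by have [_ _ h] := C1 1%N; exact: h.
Qed.

Lemma weak_gradient_lin Om a (u v : sobolev R d) : measurable Om ->
  H1 Om u -> H1 Om v -> weak_gradient Om (fval (a *: u + v)) (grad (a *: u + v)).
Proof.
move=> mOm [Lu Lgu Wu] [Lv Lgv Wv] phi tphi i.
have [Lphi Lpphi] := test_function_L2 mOm tphi.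
have := Wu phi tphi i; have := Wv phi tphi i.
have [_ _ _ lin _] := semi_inner_L2 mOm.
have := lin a _ _ _ Lu Lv (Lpphi i); rewrite /innerL2 /smul => e1.
have := lin a _ _ _ (Lgu i) (Lgv i) Lphi; rewrite /innerL2 /smul => e2.
move=> hv hu.
transitivity (\int[mu]_(x in Om) ((a *: fval u + fval v) x * partial i phi x)).
  by [].
rewrite e1 hu hv.
transitivity (- \int[mu]_(x in Om) ((a *: (fun x => grad u x ord0 i) +
   (fun x => grad v x ord0 i)) x * phi x)).
  by rewrite e2; ring.
congr (- _); apply: eq_Rintegral => x _; congr (_ * _).
by rewrite /= !mxE.
Qed.

Lemma H1_lin Om a (u v : sobolev R d) : measurable Om ->
  H1 Om u -> H1 Om v -> H1 Om (a *: u + v).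
Proof.
move=> mOm hu hv; split; last exact: weak_gradient_lin.
  by case: hu hv => ? _ _ [? _ _]; exact: L2_linear.
by case: hu hv => _ ? _ [_ ? _]; exact: L2vec_linear.
Qed.

(** The type [sobolev] also hosts the pairs [(v, grad u)], whose second component is not the
    gradient of the first; the weak gradient condition of [H1] is therefore left out. *)
Definition L2pair Om (w : sobolev R d) : Prop := L2 Om w.1 /\ L2vec Om w.2.

(** On pairs [(v, grad u)] this is the wave energy; on Sobolev functions with [c = 1] it is the
    inner product of [H^1]. Both readings are used. *)
Definition energy_form Om (c : R) (w w' : sobolev R d) : R :=
  innerL2 smul Om w.1 w'.1 + c ^+ 2 * innerL2 dot Om w.2 w'.2.

Lemma semi_inner_energy Om c : measurable Om ->
  semi_inner (L2pair Om) (energy_form Om c).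
Proof.
move=> mOm; have [z1 l1 c1 b1 p1] := semi_inner_L2 mOm.
have [z2 l2 c2 b2 p2] := semi_inner_L2vec mOm.
split.
- by [].
- by move=> a x y [? ?] [? ?]; split; [exact: l1|exact: l2].
- by move=> x y; rewrite /energy_form c1 c2.
- move=> a x y z [x1 x2] [y1 y2] [z1' z2']; rewrite /energy_form.
  rewrite -[(a *: x + y).1]/(a *: x.1 + y.1) -[(a *: x + y).2]/(a *: x.2 + y.2).
  by rewrite b1 // b2 //; ring.
- by move=> x; rewrite addr_ge0 // mulr_ge0 // sqr_ge0.
Qed.

Lemma normH1E Om (w : sobolev R d) : measurable Om -> L2pair Om w ->
  normH1 Om w = (Num.sqrt (energy_form Om 1 w w))%:E.
Proof.
move=> mOm [h1 h2]; rewrite /normH1 normL2_smulE // normL2_dotE //.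
have [_ _ _ _ p1] := semi_inner_L2 mOm.
have [_ _ _ _ p2] := semi_inner_L2vec mOm.
rewrite -!EFin_expe -EFinD poweR_EFin powR12_sqrt.
  by rewrite !sqr_sqrtr // /energy_form expr1n mul1r.
by rewrite addr_ge0 // sqr_ge0.
Qed.

(** The same combination of the approximating test functions converges, by Minkowski's inequality
    for [energy_form Om 1]. *)
Lemma H10_lin Om a (u v : sobolev R d) : measurable Om ->
  H10 Om u -> H10 Om v -> H10 Om (a *: u + v).
Proof.
move=> mOm [H1u [phi [tphi cphi]]] [H1v [psi [tpsi cpsi]]].
split; first exact: H1_lin.
exists (fun k => a *: phi k + psi k); split.
  by move=> k; exact: test_function_lin.
pose cg f : sobolev R d := (f, classical_grad f).
have tL f : test_function Om f -> L2pair Om (cg f).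
  move=> tf; have [h1 h2] := test_function_L2 mOm tf; split => // i.
  have := h2 i; congr L2; apply/funext => x.
  by rewrite /= /classical_grad mxE.
have HL (w : sobolev R d) : H1 Om w -> L2pair Om w by case.
have SI := semi_inner_energy 1 mOm.
pose x1 k := u - cg (phi k); pose x2 k := v - cg (psi k).
have P1 k : L2pair Om (x1 k).
  by apply: (semi_innerB SI); [exact: HL|exact: tL].
have P2 k : L2pair Om (x2 k).
  by apply: (semi_innerB SI); [exact: HL|exact: tL].
have xE k : a *: u + v - cg (a *: phi k + psi k) = a *: x1 k + x2 k.
  have -> : cg (a *: phi k + psi k) = a *: cg (phi k) + cg (psi k).
    congr pair; apply/funext => x; apply/rowP => i.
    rewrite /= !mxE partial_lin //.
      by have [/(_ 1%N) h _ _] := tphi k; exact: Ck_derivable h.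
    by have [/(_ 1%N) h _ _] := tpsi k; exact: Ck_derivable h.
  by rewrite /x1 /x2 scalerBr opprD addrACA.
pose r (w : sobolev R d) := Num.sqrt (energy_form Om 1 w w).
have r0 (y : nat -> sobolev R d) : (forall k, L2pair Om (y k)) ->
    (normH1 Om (y k) @[k --> \oo] --> 0%E) -> r (y k) @[k --> \oo] --> 0.
  move=> Py; rewrite (_ : (fun k => normH1 Om (y k)) = (fun k => (r (y k))%:E)).
    by move=> /fine_cvg; apply.
  by apply/funext => k; rewrite normH1E.
have r1 := r0 x1 P1 cphi; have r2 := r0 x2 P2 cpsi.
rewrite (_ : (fun k => _) = (fun k => (r (a *: x1 k + x2 k))%:E)); last first.
  apply/funext => k; rewrite -[(_, _)]/(cg _) xE normH1E //.
  by apply: (semi_innerD SI) => //; exact: (semi_innerZ SI).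
apply: cvg_EFin; first by apply: nearW.
apply: (@squeeze_cvgr _ _ _ _ (fun=> 0) (fun k => `|a| * r (x1 k) + r (x2 k))).
- apply: nearW => k; rewrite sqrtr_ge0 /=.
  exact: (semi_inner_minkowski SI).
- exact: cvg_cst.
- by have := cvgD (cvgMl_tmp (a := `|a|) r1) r2; rewrite mulr0 addr0; exact.
Qed.

Lemma polynomial_on_lin p (D : set X) a f g :
  polynomial_on p D f -> polynomial_on p D g -> polynomial_on p D (a *: f + g).
Proof.
move=> [c1 h1] [c2 h2]; exists (fun al => a * c1 al + c2 al) => x Dx.
rewrite -[_ x]/(a * f x + g x) h1 // h2 // mulr_sumr -big_split.
by apply: eq_bigr => al _; rewrite mulrDl mulrA.
Qed.

Lemma Vh_lin Om Th p a (u v : sobolev R d) : measurable Om ->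
  Vh Om Th p u -> Vh Om Th p v -> Vh Om Th p (a *: u + v).
Proof.
move=> mOm [Hu pu] [Hv pv]; split; first exact: H10_lin.
by move=> K KT; apply: polynomial_on_lin; [exact: pu|exact: pv].
Qed.

Lemma Vh_sum Om Th p q (phi : 'I_q.+1 -> sobolev R d) (a : 'I_q.+1 -> R) :
  measurable Om -> (forall j, Vh Om Th p (phi j)) ->
  Vh Om Th p (\sum_j a j *: phi j).
Proof.
move=> mOm Hphi; apply: (big_ind (Vh Om Th p)).
(* The family is nonempty, so 0 is obtained as a difference of one of its members with itself. *)
- by rewrite -(addNr (phi ord0)) -scaleN1r; exact: Vh_lin.
- by move=> u v Hu Hv; rewrite -[u]scale1r; exact: Vh_lin.
- move=> j _; rewrite -[_ *: _]addr0 -(addNr (phi ord0)) -scaleN1r.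
  by apply: Vh_lin => //; exact: Vh_lin.
Qed.

Lemma Vh_L2 Om Th p (u : sobolev R d) : Vh Om Th p u ->
  L2 Om (fval u) /\ L2vec Om (grad u).
Proof. by move=> [[[]]]. Qed.

End sobolev_linear.
(** * Piecewise polynomials in time *)

Section time_polynomials.
Context {R : realType} {d : nat} {V : normedModType R}.
Local Notation X := 'rV[R]_d.
Implicit Types (F G : R -> X -> V) (a b t : R).

Lemma cvg_sum_scale (T : Type) (FF : set_system T) m (s : 'I_m -> T -> R)
    (k : 'I_m -> R) (v : 'I_m -> V) : Filter FF ->
  (forall j, s j x @[x --> FF] --> k j) ->
  \sum_j s j x *: v j @[x --> FF] --> \sum_j k j *: v j.
Proof.
move=> FFF sk; elim: (index_enum _) => [|j r ih].
  rewrite big_nil; under eq_fun do rewrite big_nil; exact: cvg_cst.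
rewrite big_cons; under eq_fun do rewrite big_cons.
by apply: cvgD => //; apply: cvgZr_tmp; exact: sk.
Qed.

Section piece.
Context (m : nat) (P : 'I_m -> {poly R}) (c : 'I_m -> X -> V) (F : R -> X -> V).
Context (a b : R) (ab : a < b).
Hypothesis FE : forall t, a < t < b -> F t = \sum_j (P j).[t] *: c j.

Let FEx t x : a < t < b -> F t x = \sum_j (P j).[t] *: c j x.
Proof. by move=> /FE ->; rewrite fct_sumE. Qed.

Lemma trace_right_piece : trace_right F a = \sum_j (P j).[a] *: c j.
Proof.
apply/funext => x; rewrite fct_sumE; apply/cvg_lim; first exact: norm_hausdorff.
have h : \sum_j (P j).[s] *: c j x @[s --> a^'+] --> \sum_j (P j).[a] *: c j x.
  apply: cvg_sum_scale => j.
  by apply: cvg_at_right_filter; exact: continuous_horner.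
apply: cvg_trans h; apply: near_eq_cvg; near=> s; rewrite FEx //.
by apply/andP; split; near: s; [exact: nbhs_right_gt|exact: nbhs_right_lt].
Unshelve. all: by end_near. Qed.

Lemma trace_left_piece : trace_left F b = \sum_j (P j).[b] *: c j.
Proof.
apply/funext => x; rewrite fct_sumE; apply/cvg_lim; first exact: norm_hausdorff.
have h : \sum_j (P j).[s] *: c j x @[s --> b^'-] --> \sum_j (P j).[b] *: c j x.
  apply: cvg_sum_scale => j.
  by apply: cvg_at_left_filter; exact: continuous_horner.
apply: cvg_trans h; apply: near_eq_cvg; near=> s; rewrite FEx //.
by apply/andP; split; near: s; [exact: nbhs_left_gt|exact: nbhs_left_lt].
Unshelve. all: by end_near. Qed.

Lemma dt_piece t : a < t < b -> dt F t = \sum_j ((P j)^`()).[t] *: c j.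
Proof.
move=> tab; apply/funext => x; rewrite fct_sumE /dt.
apply/cvg_lim; first exact: norm_hausdorff.
have near0 : \forall h \near 0^', a < h + t < b.
  have [ta tb] := andP tab.
  have e0 : 0 < Num.min (t - a) (b - t) by rewrite lt_min !subr_gt0 ta tb.
  near=> h.
  have : `|h| < Num.min (t - a) (b - t).
    by near: h; apply: dnbhs0_lt.
  by rewrite lt_min !ltr_norml => /andP[/andP[h1 h2] /andP[h3 h4]]; lra.
have h : \sum_j (h^-1 * ((P j).[h + t] - (P j).[t])) *: c j x @[h --> 0^'] -->
    \sum_j ((P j)^`()).[t] *: c j x.
  apply: cvg_sum_scale => j.
  have dh : derivable (horner (P j)) t 1 by exact: derivable_horner.
  rewrite derivE derive1E.
  have -> : (fun h => h^-1 * ((P j).[h + t] - (P j).[t])) =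
      (fun h => h^-1 *: ((horner (P j) \o shift t) (h *: 1) - (P j).[t])).
    by apply/funext => h; rewrite /= -[h *: 1]/(h * 1) mulr1.
  exact: dh.
apply: cvg_trans h; apply: near_eq_cvg; near=> h.
rewrite FEx; last by near: h; exact: near0.
rewrite FEx // -sumrB scaler_sumr; apply: eq_bigr => j _.
by rewrite -scalerBl scalerA.
Unshelve. all: by end_near. Qed.

End piece.
End time_polynomials.

(** * The local time variable of a slab *)

Section local_variable.
Context {R : realType}.
Implicit Types (a b t : R) (p : {poly R}).

Definition local_var a b : {poly R} := (b - a)^-1 *: ('X - a%:P).

Lemma local_varE a b t : (local_var a b).[t] = (t - a) / (b - a).
Proof. by rewrite !hornerE mulrC. Qed.

Lemma local_var_left a b : (local_var a b).[a] = 0.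
Proof. by rewrite local_varE subrr mul0r. Qed.

Lemma local_var_right a b : a < b -> (local_var a b).[b] = 1.
Proof. by move=> ab; rewrite local_varE divff // subr_eq0 gt_eqF. Qed.

Lemma local_var_itv a b t : a < t < b -> 0 <= (local_var a b).[t] <= 1.
Proof.
move=> /andP[a_t tb]; have ab := lt_trans a_t tb.
rewrite local_varE divr_ge0 ?ler_pdivrMr ?subr_gt0 // ?mul1r ?subr_ge0 ?(ltW ab)
  ?(ltW a_t) //.
by rewrite lerD2r ltW.
Qed.

Lemma deriv_local a b p :
  (p \Po local_var a b)^`() = (b - a)^-1 *: (p^`() \Po local_var a b).
Proof. by rewrite deriv_comp derivZ derivXsubC -scalerAr mulr1. Qed.

Lemma size_local a b p q : (size p <= q.+1)%N ->
  (size (p \Po local_var a b) <= q.+1)%N.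
Proof.
move=> sp; apply: leq_trans (size_comp_poly_leq _ _) _.
have : (size (local_var a b) <= 2)%N.
  by apply: leq_trans (size_scale_leq _ _) _; rewrite size_XsubC.
by move: sp; case: (size p) => [|k]; case: (size (local_var a b)) => [|l]; nia.
Qed.

(** Returns from arbitrary polynomial weights to the powers of the global time [t], the form in
    which [Vdisc] is stated. *)
Lemma sum_poly_coef (E : lmodType R) q (P : 'I_q.+1 -> {poly R})
    (U : 'I_q.+1 -> E) t :
  (forall i, (size (P i) <= q.+1)%N) ->
  \sum_i (P i).[t] *: U i = \sum_(j < q.+1) t ^+ j *: \sum_i (P i)`_j *: U i.
Proof.
move=> sP; under [RHS]eq_bigr do rewrite scaler_sumr.
rewrite exchange_big; apply: eq_bigr => i _.
rewrite (horner_coef_wide _ (sP i)) scaler_suml; apply: eq_bigr => j _.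
by rewrite scalerA mulrC.
Qed.

(* [t = a + (b - a) s] *)
Lemma local_monomials (E : lmodType R) q a b (phi : 'I_q.+1 -> E) : a < b ->
  exists c : 'I_q.+1 -> 'I_q.+1 -> R, forall t,
    \sum_(j < q.+1) t ^+ j *: phi j =
    \sum_(j < q.+1) (monomials j \Po local_var a b).[t] *: \sum_i c j i *: phi i.
Proof.
move=> ab; pose A (i : 'I_q.+1) : {poly R} := (a%:P + (b - a) *: 'X) ^+ i.
exists (fun j i => (A i)`_j) => t.
have sA i : (size (A i) <= q.+1)%N.
  apply: leq_trans (size_exp_leq _ _) _; rewrite ltnS.
  have s2 : (size (a%:P + (b - a) *: 'X : {poly R})%R <= 2)%N.
    apply: leq_trans (size_polyD _ _) _; rewrite geq_max.
    rewrite (leq_trans (size_polyC_leq1 _)) //=.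
    by apply: leq_trans (size_scale_leq _ _) _; rewrite size_polyX.
  have := ltn_ord i; rewrite ltnS; apply: leq_trans.
  rewrite -[X in (_ <= X)%N]mul1n leq_mul2r.
  by case: (size _) s2 => [|[|[|]]]; rewrite ?orbT.
transitivity (\sum_i (A i).[(local_var a b).[t]] *: phi i).
  apply: eq_bigr => i _; rewrite /A horner_exp local_varE; congr (_ ^+ _ *: _).
  by rewrite hornerD hornerC hornerZ hornerX; field; rewrite subr_eq0 gt_eqF.
rewrite (sum_poly_coef _ _ sA); apply: eq_bigr => j _.
by rewrite horner_comp /monomials hornerXn.
Qed.

End local_variable.

Section slab_integrals.
Context {R : realType} {d : nat} {V : normedModType R} (ip : V -> V -> R).
Context (Om : set 'rV[R]_d) (P : ('rV[R]_d -> V) -> Prop).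
Hypothesis SI : semi_inner P (innerL2 ip Om).
Context (q : nat) (a b : R) (ab : a < b).
Implicit Types (c e : 'I_q.+1 -> {poly R}) (F G : R -> 'rV[R]_d -> V).

(** A version of [curve_inner] with two coefficient families, since the coupling terms pair [u] with
    [v]. *)
Definition cross_inner (U W : 'I_q.+1 -> 'rV[R]_d -> V) c e : {poly R} :=
  \sum_i \sum_j innerL2 ip Om (U i) (W j) *: (c i * e j).

Definition is_slab_curve (U : 'I_q.+1 -> 'rV[R]_d -> V) c F : Prop :=
  forall t, a < t < b -> F t = \sum_j (c j \Po local_var a b).[t] *: U j.

Context (U W : 'I_q.+1 -> 'rV[R]_d -> V).
Hypotheses (PU : forall j, P (U j)) (PW : forall j, P (W j)).

Lemma inner_slab_cross c e F G : is_slab_curve U c F -> is_slab_curve W e G ->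
  inner_slab ip Om a b F G = (b - a) * pint (cross_inner U W c e).
Proof.
move=> HF HG; rewrite -integral_rescale_poly //; apply: eq_Rintegral => t.
rewrite inE /= in_itv /= => tab.
rewrite HF // HG // (semi_inner_suml SI) //; last first.
  by apply: (semi_inner_sum SI) => j; exact: (semi_innerZ SI).
rewrite horner_sum; apply: eq_bigr => i _; rewrite (semi_inner_sumr SI) //.
rewrite horner_sum mulr_sumr; apply: eq_bigr => j _.
by rewrite hornerZ hornerM !horner_comp local_varE; ring.
Qed.

(** The factor [1 / (b - a)] of the chain rule cancels the length of the slab, so this term is
    independent of the step size. *)
Lemma inner_slab_dt_cross c e F G : is_slab_curve U c F -> is_slab_curve W e G ->
  inner_slab ip Om a b (dt F) G =
  pint (cross_inner U W (fun i => (c i)^`()) e).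
Proof.
move=> HF HG.
have HdF : is_slab_curve U (fun i => (b - a)^-1 *: (c i)^`()) (dt F).
  move=> t tab; rewrite (dt_piece HF tab); apply: eq_bigr => j _.
  by rewrite deriv_local comp_polyZ.
rewrite (inner_slab_cross HdF HG) -pintZ; congr pint.
rewrite scaler_sumr; apply: eq_bigr => i _; rewrite scaler_sumr.
apply: eq_bigr => j _; rewrite -scalerAl !scalerA; congr (_ *: _).
by field; rewrite subr_eq0 gt_eqF.
Qed.

Lemma slab_curve_right c F : is_slab_curve U c F ->
  trace_right F a = \sum_j (c j).[0] *: U j.
Proof.
move=> HF; rewrite (trace_right_piece ab HF); apply: eq_bigr => j _.
by rewrite horner_comp local_var_left.
Qed.

Lemma slab_curve_left c F : is_slab_curve U c F ->
  trace_left F b = \sum_j (c j).[1] *: U j.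
Proof.
move=> HF; rewrite (trace_left_piece ab HF); apply: eq_bigr => j _.
by rewrite horner_comp local_var_right.
Qed.

End slab_integrals.

(** * Test functions supported in a single slab *)

Section localized_tests.
Context {R : realType} {d : nat} {V : normedModType R} (ip : V -> V -> R).
Context (Om : set 'rV[R]_d) (P : ('rV[R]_d -> V) -> Prop).
Hypothesis SI : semi_inner P (innerL2 ip Om).
Context (T : R) (N : nat) (ts : nat -> R).
Hypothesis hts : time_partition T N ts.
Implicit Types (F G : R -> 'rV[R]_d -> V).

Lemma time_partition_le m n : (m <= n)%N -> (n <= N)%N -> ts m <= ts n.
Proof.
move=> mn nN; have [_ _ inc] := hts.
elim: n mn nN => [|n ih]; first by rewrite leqn0 => /eqP ->.
rewrite leq_eqVlt => /predU1P[-> //|]; rewrite ltnS => mn nN.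
by apply: le_trans (ih mn (ltnW nN)) _; exact/ltW/inc.
Qed.

Lemma slab_disjoint m n t : (m < N)%N -> (n < N)%N -> m != n ->
  ts m < t < ts m.+1 -> ~~ (ts n < t < ts n.+1).
Proof.
move=> mN nN; rewrite neq_ltn => /orP[mn|nm] /andP[t1 t2];
  apply/negP => /andP[t3 t4].
  by have := time_partition_le mn (ltnW nN); rewrite leNgt (lt_trans t3 t2).
by have := time_partition_le nm (ltnW mN); rewrite leNgt (lt_trans t1 t4).
Qed.

Lemma slab_subset n t : (n < N)%N -> ts n < t < ts n.+1 -> 0 < t < T.
Proof.
move=> nN /andP[t1 t2]; have [t0 tN _] := hts; apply/andP; split.
  by rewrite -t0; apply: le_lt_trans t1; exact: time_partition_le (ltnW nN).
by rewrite -tN; apply: lt_le_trans t2 _; exact: time_partition_le.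
Qed.

Context (n : nat) (nN : (n < N)%N).
Context (G : R -> 'rV[R]_d -> V).
Hypothesis G0 : forall t, ~~ (ts n < t < ts n.+1) -> G t = 0.


Lemma innerL2_0r (f : 'rV[R]_d -> V) : (forall x, ip x 0 = 0) ->
  innerL2 ip Om f 0 = 0.
Proof.
move=> h; rewrite /innerL2 /Rintegral.
by rewrite (eq_integral (cst 0%E)) ?integral0 // => x _; rewrite h.
Qed.

Hypothesis ip_0r : forall x, ip x 0 = 0.

Lemma inner_slab_restrict F :
  inner_slab ip Om 0 T F G = inner_slab ip Om (ts n) (ts n.+1) F G.
Proof.
rewrite /inner_slab Rintegral_mkcond [RHS]Rintegral_mkcond.
apply: eq_Rintegral => t _; rewrite /patch !mem_setE !in_itv /=.
have [tn|tn] := boolP (ts n < t < ts n.+1); first by rewrite (slab_subset nN tn).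
by rewrite G0 // innerL2_0r //; case: ifP.
Qed.

Lemma inner_slab_off m F : (m < N)%N -> m != n ->
  inner_slab ip Om (ts m) (ts m.+1) F G = 0.
Proof.
move=> mN mn; rewrite /inner_slab /Rintegral (eq_integral (cst 0%E)) ?integral0 //.
move=> t; rewrite inE /= in_itv /= => tm.
by rewrite G0 ?innerL2_0r //; exact: (slab_disjoint mN nN mn tm).
Qed.

Lemma trace_right_off m : (m < N)%N -> m != n -> trace_right G (ts m) = 0.
Proof.
move=> mN mn; have [_ _ inc] := hts.
(* On another slab [G] is zero, that is, a piece with an empty family of coefficients. *)
rewrite (@trace_right_piece _ _ _ 0 (fun=> 0) (fun=> 0) G _ _ (inc _ mN));
  rewrite ?big_ord0 //.
move=> t tm; rewrite big_ord0 G0 //; exact: (slab_disjoint mN nN mn tm).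
Qed.

(** [G] enters through right traces, so it sees the jump at the left end of its slab but not the one
    at the right end. On the first slab the initial term replaces the jump, with [f0] as incoming
    value. Slab [n] here is the term [n.+1] of the first sum in [Dtau]. *)
Lemma Dtau_local F (f0 : 'rV[R]_d -> V) :
  P (trace_right F (ts n)) -> P f0 -> P (trace_right G (ts n)) ->
  Dtau ip Om N ts F G - innerL2 ip Om f0 (trace_right G 0) =
  inner_slab ip Om (ts n) (ts n.+1) (dt F) G
  + innerL2 ip Om
      (trace_right F (ts n) - if n is 0 then f0 else trace_left F (ts n))
      (trace_right G (ts n)).
Proof.
move=> P1 P2 P3; have [t0 tN inc] := hts; rewrite /Dtau.
rewrite big_add1 /= big_mkord (bigD1 (Ordinal nN)) //= big1 ?addr0; last first.
  by move=> m mn; apply: inner_slab_off.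
rewrite -!addrA; congr (_ + _).
case: n nN P1 P3 G0 inner_slab_off trace_right_off => [|k] kN P1 P3 _ _ off.
  rewrite big_nat big1 ?add0r; last first.
    move=> m /andP[m1 mN]; rewrite off ?innerL2_0r //.
    by case: m m1 mN.
  by rewrite t0 in P1 P3 *; rewrite (semi_innerBl SI).
have -> : trace_right G 0 = 0.
  by rewrite -t0 off // (leq_trans _ kN).
rewrite !innerL2_0r // subrr addr0.
rewrite (bigD1_seq k.+1) ?iota_uniq ?mem_index_iota //= big_nat_cond big1 ?addr0 //.
by move=> m /andP[/andP[m1 mN] mk]; rewrite off ?innerL2_0r.
Qed.

End localized_tests.

(** * The wave system on one time slab *)

Section pair_sums.
Context {R : realType} {d : nat}.

Lemma fval_sum m (a : 'I_m -> R) (phi : 'I_m -> sobolev R d) :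
  fval (\sum_j a j *: phi j) = \sum_j a j *: fval (phi j).
Proof. by rewrite /fval (big_morph fst (id1 := 0) (op1 := +%R)). Qed.

Lemma grad_sum m (a : 'I_m -> R) (phi : 'I_m -> sobolev R d) :
  grad (\sum_j a j *: phi j) = \sum_j a j *: grad (phi j).
Proof. by rewrite /grad (big_morph snd (id1 := 0) (op1 := +%R)). Qed.

End pair_sums.

Section slab_step.
Context {R : realType} {d : nat} (q : nat).
Local Notation S := (sobolev R d).
Context (Om : set 'rV[R]_d) (mOm : measurable Om).
Context (Th : {fset {fset 'rV[R]_d}}) (p : nat).
Context (T : R) (N : nat) (ts : nat -> R) (hts : time_partition T N ts).
Context (c : R) (hc : 0 < c).
Context (n : nat) (nN : (n < N)%N).
Local Notation a := (ts n).
Local Notation b := (ts n.+1).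

Implicit Types e : 'I_q.+1 -> {poly R}.

Let ab : a < b. Proof. by case: hts => _ _; apply. Qed.

Definition localized (W : 'I_q.+1 -> S) (e : 'I_q.+1 -> {poly R}) (t : R) : S :=
  if a < t < b then \sum_j (e j \Po local_var a b).[t] *: W j else 0.

Lemma localized_Vdisc W e : (forall j, Vh Om Th p (W j)) ->
  (forall j, (size (e j) <= q.+1)%N) -> Vdisc Om Th p N ts q (localized W e).
Proof.
move=> HW se m mN; have [->|mn] := eqVneq m n.
  exists (fun k => \sum_j (e j \Po local_var a b)`_k *: W j); split.
    by move=> k; exact: Vh_sum.
  move=> t tab; rewrite /localized tab sum_poly_coef // => j.
  exact: size_local.
exists (fun=> 0); split.
  have := @Vh_sum _ _ Om Th p q W (fun=> 0) mOm HW.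
  by rewrite big1 // => i _; rewrite scale0r.
move=> t tm; rewrite /localized (negbTE (slab_disjoint hts mN nN mn tm)).
by rewrite big1 // => i _; rewrite scaler0.
Qed.

Lemma localized_off W e t : ~~ (a < t < b) -> localized W e t = 0.
Proof. by move=> /negbTE h; rewrite /localized h. Qed.

Context (U V : 'I_q.+1 -> S).
Hypotheses (HU : forall j, Vh Om Th p (U j)) (HV : forall j, Vh Om Th p (V j)).
Context (u v : R -> S).
Hypothesis uE : forall t, a < t < b ->
  u t = \sum_j (monomials j \Po local_var a b).[t] *: U j.
Hypothesis vE : forall t, a < t < b ->
  v t = \sum_j (monomials j \Po local_var a b).[t] *: V j.

Definition energy_coef (j : 'I_q.+1) : S := (fval (V j), grad (U j)).

Lemma energy_coefP j : L2pair Om (energy_coef j).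
Proof. by have [? _] := Vh_L2 (HV j); have [_ ?] := Vh_L2 (HU j). Qed.

Let S1 := semi_inner_L2 mOm.
Let S2 := semi_inner_L2vec mOm.
Let SE := semi_inner_energy c mOm.
Let PV j : L2 Om (fval (V j)). Proof. by case: (Vh_L2 (HV j)). Qed.
Let PgV j : L2vec Om (grad (V j)). Proof. by case: (Vh_L2 (HV j)). Qed.
Let PgU j : L2vec Om (grad (U j)). Proof. by case: (Vh_L2 (HU j)). Qed.
Local Notation Y := (curve energy_coef).
Local Notation EB := (energy_form Om c).

Lemma fval_slab (W : 'I_q.+1 -> S) e (w : R -> S) :
  (forall t, a < t < b -> w t = \sum_j (e j \Po local_var a b).[t] *: W j) ->
  is_slab_curve a b (fun j => fval (W j)) e (fun t => fval (w t)).
Proof. by move=> h t tab; rewrite h // fval_sum. Qed.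

Lemma grad_slab (W : 'I_q.+1 -> S) e (w : R -> S) :
  (forall t, a < t < b -> w t = \sum_j (e j \Po local_var a b).[t] *: W j) ->
  is_slab_curve a b (fun j => grad (W j)) e (fun t => grad (w t)).
Proof. by move=> h t tab; rewrite h // grad_sum. Qed.

Lemma localizedE W e t : a < t < b ->
  localized W e t = \sum_j (e j \Po local_var a b).[t] *: W j.
Proof. by move=> h; rewrite /localized h. Qed.

Lemma curve_fst e s : (Y e s).1 = \sum_j (e j).[s] *: fval (V j).
Proof. exact: (fval_sum (fun j => (e j).[s]) energy_coef). Qed.

Lemma curve_snd e s : (Y e s).2 = \sum_j (e j).[s] *: grad (U j).
Proof. exact: (grad_sum (fun j => (e j).[s]) energy_coef). Qed.

Lemma energy_curve_inner e e' :
  curve_inner EB energy_coef e e' =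
  cross_inner smul Om (fun j => fval (V j)) (fun j => fval (V j)) e e' +
  c ^+ 2 *: cross_inner dot Om (fun j => grad (U j)) (fun j => grad (U j)) e e'.
Proof.
rewrite scaler_sumr -big_split; apply: eq_bigr => i _.
rewrite scaler_sumr -big_split; apply: eq_bigr => j _.
by rewrite /= scalerA -scalerDl.
Qed.

(* The coupling terms of the two equations cancel when the test family is
   symmetric with respect to the monomials. *)
Lemma coupling_cancel e :
  (forall i j : 'I_q.+1, pint (monomials i * e j) = pint (monomials j * e i)) ->
  inner_slab dot Om a b (fun t => grad (u t)) (fun t => grad (localized V e t)) =
  inner_slab dot Om a b (fun t => grad (v t)) (fun t => grad (localized U e t)).
Proof.
move=> sym.
rewrite (inner_slab_cross S2 ab PgU PgV (grad_slab uE)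
  (grad_slab (@localizedE V e))).
rewrite (inner_slab_cross S2 ab PgV PgU (grad_slab vE)
  (grad_slab (@localizedE U e))).
congr (_ * _); rewrite !linear_sum.
under eq_bigr do rewrite linear_sum; under [RHS]eq_bigr do rewrite linear_sum.
rewrite exchange_big; apply: eq_bigr => i _; apply: eq_bigr => j _ /=.
have [_ _ symB _ _] := S2.
by rewrite !pintZ symB sym.
Qed.

Context (f : R -> 'rV[R]_d -> R) (u0 : S) (v0 : 'rV[R]_d -> R) (Ups : R -> S).
Hypotheses (hu0 : H10 Om u0) (hv0 : L2 Om v0).

Hypothesis eq1 : forall z : R -> sobolev R d, Vdisc Om Th p N ts q z ->
  c ^+ 2 * inner_slab dot Om 0 T (fun t => grad (v t)) (fun t => grad (z t))
  = c ^+ 2 * Dtau dot Om N ts (fun t => grad (u t)) (fun t => grad (z t))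
    - c ^+ 2 * innerL2 dot Om (grad u0)
                 (trace_right (fun t => grad (z t)) 0)
    + c ^+ 2 * inner_slab dot Om 0 T (fun t => grad (Ups t))
                 (fun t => grad (z t)).
Hypothesis eq2 : forall w : R -> sobolev R d, Vdisc Om Th p N ts q w ->
  Dtau smul Om N ts (fun t => fval (v t)) (fun t => fval (w t))
  + c ^+ 2 * inner_slab dot Om 0 T (fun t => grad (u t)) (fun t => grad (w t))
  = inner_slab smul Om 0 T f (fun t => fval (w t))
    + innerL2 smul Om v0 (trace_right (fun t => fval (w t)) 0).

(** The minus sign arises because in the first equation the source stands on the same side as
    [Dtau]. *)
Definition slab_load e : R :=
  inner_slab smul Om a b f (fun t => fval (localized V e t))
  - c ^+ 2 * inner_slab dot Om a b (fun t => grad (Ups t))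
               (fun t => grad (localized U e t)).

Definition incoming : S :=
  (if n is 0 then v0 else trace_left (fun t => fval (v t)) a,
   if n is 0 then grad u0 else trace_left (fun t => grad (u t)) a).

(** The second equation is tested with the coefficients of [v], the first with those of [u], both
    with the weights [e]. Symmetry of [e] equates the two coupling terms, and the derivative and
    jump terms assemble into the energy form. *)
Lemma slab_equation e :
  (forall j, (size (e j) <= q.+1)%N) ->
  (forall i j : 'I_q.+1, pint (monomials i * e j) = pint (monomials j * e i)) ->
  pint (curve_inner EB energy_coef (@dmonomials R q) e)
  + EB (Y (@monomials R q) 0 - incoming) (Y e 0) = slab_load e.
Proof.
move=> se sym.
have E2 := eq2 (localized_Vdisc HV se); have E1 := eq1 (localized_Vdisc HU se).
have offf W t : ~~ (a < t < b) -> fval (localized W e t) = 0.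
  by move=> /localized_off ->.
have offg W t : ~~ (a < t < b) -> grad (localized W e t) = 0.
  by move=> /localized_off ->.
have s0 (x : R) : smul x 0 = 0 by rewrite /smul mulr0.
have d0 (x : 'rV[R]_d) : dot x 0 = 0.
  by rewrite /dot big1 // => i _; rewrite mxE mulr0.
rewrite !(inner_slab_restrict Om hts nN (offf V) s0)
  !(inner_slab_restrict Om hts nN (offg V) d0) in E2.
rewrite !(inner_slab_restrict Om hts nN (offg U) d0) in E1.
have lV := fval_slab (@localizedE V e); have lU := grad_slab (@localizedE U e).
have Tv := slab_curve_right ab (fval_slab vE).
have Tw := slab_curve_right ab lV.
have Tu := slab_curve_right ab (grad_slab uE).
have Tz := slab_curve_right ab lU.
have su0 : L2vec Om (grad u0) by case: hu0 => [[]].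
have D2 := @Dtau_local _ _ _ smul Om _ S1 T N ts hts n nN _ (offf V) s0
  (fun t => fval (v t)) v0.
have D1 := @Dtau_local _ _ _ dot Om _ S2 T N ts hts n nN _ (offg U) d0
  (fun t => grad (u t)) (grad u0).
rewrite Tv Tw in D2; rewrite Tu Tz in D1.
have sum1 (W : 'I_q.+1 -> 'rV[R]_d -> R) (r : 'I_q.+1 -> R) :
    (forall j, L2 Om (W j)) -> L2 Om (\sum_j r j *: W j).
  by move=> PW; apply: (semi_inner_sum S1) => j; exact: (semi_innerZ S1).
have sum2 (W : 'I_q.+1 -> 'rV[R]_d -> 'rV[R]_d) (r : 'I_q.+1 -> R) :
    (forall j, L2vec Om (W j)) -> L2vec Om (\sum_j r j *: W j).
  by move=> PW; apply: (semi_inner_sum S2) => j; exact: (semi_innerZ S2).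
have {}D2 := D2 (sum1 _ _ PV) hv0 (sum1 _ _ PV).
have {}D1 := D1 (sum2 _ _ PgU) su0 (sum2 _ _ PgU).
rewrite (inner_slab_dt_cross S1 ab PV PV (fval_slab vE) lV) in D2.
rewrite (inner_slab_dt_cross S2 ab PgU PgU (grad_slab uE) lU) in D1.
have CC := coupling_cancel sym.
rewrite energy_curve_inner pintD pintZ /energy_form.
rewrite -[(Y _ 0 - incoming).1]/((Y (@monomials R q) 0).1 - incoming.1).
rewrite -[(Y _ 0 - incoming).2]/((Y (@monomials R q) 0).2 - incoming.2).
rewrite !curve_fst !curve_snd /slab_load /incoming /=.
set X1 := pint (cross_inner smul _ _ _ _ _).
set X2 := pint (cross_inner dot _ _ _ _ _).
rewrite -[pint (cross_inner smul _ _ _ _ _)]/X1 in D2.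
rewrite -[pint (cross_inner dot _ _ _ _ _)]/X2 in D1.
rewrite CC in E2; move: D1 D2 E1 E2.
move: (Dtau smul _ _ _ _ _) (Dtau dot _ _ _ _ _) => A2 A1.
move: (inner_slab _ _ _ _ _ _) (inner_slab _ _ _ _ _ _) (inner_slab _ _ _ _ _ _).
move: (innerL2 dot Om (grad u0) _) (innerL2 smul Om v0 _) => I1 I2.
move: (innerL2 dot Om _ _) (innerL2 smul Om _ _) => J2 J1 Z1 Z2 Z3 D1 D2 E1 E2.
(* What remains is linear in the products with [c ^+ 2], so the identity for the gradients is
   multiplied out first. *)
have {}D1 := congr1 (fun x => c ^+ 2 * x) D1; rewrite /= mulrBr mulrDr in D1.
lra.
Qed.

Lemma energy_fst_le e s y : 0 <= y -> EB (Y e s) (Y e s) <= y ^+ 2 ->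
  Num.sqrt (innerL2 smul Om (Y e s).1 (Y e s).1) <= y.
Proof.
move=> y0 h; have [_ _ _ _ p2] := S2.
rewrite -(ger0_norm y0) -sqrtr_sqr ler_wsqrtr //; apply: le_trans h.
by rewrite /energy_form lerDl mulr_ge0 ?sqr_ge0.
Qed.

Lemma energy_snd_le e s y : 0 <= y -> EB (Y e s) (Y e s) <= y ^+ 2 ->
  c * Num.sqrt (innerL2 dot Om (Y e s).2 (Y e s).2) <= y.
Proof.
move=> y0 h; have [_ _ _ _ p1] := S1; have [_ _ _ _ p2] := S2.
rewrite -[X in X * _]ger0_norm ?(ltW hc) // -sqrtr_sqr -sqrtrM ?sqr_ge0 //.
rewrite -(ger0_norm y0) -sqrtr_sqr ler_wsqrtr //; apply: le_trans h.
by rewrite /energy_form lerDr.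
Qed.

Local Notation Df :=
  (\int[lebesgue_measure]_(t in `]a, b[) normL2 smul Om (f t))%E.
Local Notation DU :=
  (\int[lebesgue_measure]_(t in `]a, b[) normL2 dot Om (grad (Ups t)))%E.

Hypothesis mf : forall t, a < t < b -> measurable_fun Om (f t).
Hypothesis LU : forall t, a < t < b -> L2vec Om (grad (Ups t)).
Hypotheses (Dfoo : (Df < +oo)%E) (DUoo : (DU < +oo)%E).

(** The energy controls only [c] times the norm of the gradient part of the test, which is thus at
    most [y / c]; the prefactor [c ^+ 2] turns this into [c * y]. *)
Lemma slab_load_bound e y : 0 <= y ->
  (forall s, 0 <= s <= 1 -> EB (Y e s) (Y e s) <= y ^+ 2) ->
  `|slab_load e| <= y * (fine Df + c * fine DU).
Proof.
move=> y0 ey.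
have locY t : a < t < b ->
    localized V e t = \sum_j (e j).[(local_var a b).[t]] *: V j.
  by move=> tab; rewrite localizedE //; apply: eq_bigr => j _; rewrite horner_comp.
have locYU t : a < t < b ->
    localized U e t = \sum_j (e j).[(local_var a b).[t]] *: U j.
  by move=> tab; rewrite localizedE //; apply: eq_bigr => j _; rewrite horner_comp.
have B1 : `|inner_slab smul Om a b f (fun t => fval (localized V e t))|
    <= y * fine Df.
  apply: normr_Rintegral_le_lower => // t; rewrite /= in_itv /= => tab.
    exact: normL2_ge0.
  rewrite locY // fval_sum -curve_fst.
  have [h1 _] : L2pair Om (Y e (local_var a b).[t]).
    exact: (curve_in SE energy_coefP).
  apply: cauchy_normL2_smul => //; first exact: mf.
  by apply: energy_fst_le => //; apply: ey; exact: local_var_itv.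
have B2 : `|inner_slab dot Om a b (fun t => grad (Ups t))
    (fun t => grad (localized U e t))| <= y / c * fine DU.
  apply: normr_Rintegral_le_lower => //.
  - by rewrite divr_ge0 // ltW.
  - by move=> t _; exact: normL2_ge0.
  move=> t; rewrite /= in_itv /= => tab; rewrite locYU // grad_sum -curve_snd.
  have [_ h2] : L2pair Om (Y e (local_var a b).[t]).
    exact: (curve_in SE energy_coefP).
  rewrite normL2_dotE //; last exact: LU.
  rewrite -EFinM lee_fin mulrC.
  apply: le_trans (semi_inner_cauchy_sqrt S2 (LU tab) h2) _.
  rewrite ler_wpM2l ?sqrtr_ge0 // ler_pdivlMr // mulrC.
  by apply: energy_snd_le => //; apply: ey; exact: local_var_itv.
apply: le_trans (ler_normB _ _) _; rewrite mulrDr lerD // normrM.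
rewrite ger0_norm ?sqr_ge0 //.
apply: le_trans (ler_wpM2l (sqr_ge0 c) B2) _.
rewrite le_eqVlt; apply/orP; left; apply/eqP; field.
by rewrite gt_eqF.
Qed.

Lemma slab_step_bounds :
  let D := fine Df + c * fine DU in
  let y := curve_size EB energy_coef in
  let J := Y (@monomials R q) 0 - incoming in
  let e1 := EB (Y (@monomials R q) 1) (Y (@monomials R q) 1) in
  L2pair Om incoming ->
  e1 + Num.sqrt (EB J J) ^+ 2 <= EB incoming incoming + 2 * (y * D) /\
  y ^+ 2 <= rkernel_bound q *
     (e1 + 2 * (Num.sqrt (EB J J) * y) + 2 * (y * D)).
Proof.
move=> D y J e1 Pinc.
have y0 : 0 <= y by exact: sqrtr_ge0.
have K0 : 0 <= rkernel_bound q :> R by exact: le_trans ler01 (rkernel_bound_ge1 q).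
have yE : y ^+ 2 = rkernel_bound q *
    pint (curve_inner EB energy_coef (@monomials R q) (@monomials R q)).
  by rewrite sqr_sqrtr // mulr_ge0 // (curve_mean_ge0 SE energy_coefP).
have sm (j : 'I_q.+1) : (size (monomials j : {poly R}) <= q.+1)%N.
  by rewrite /monomials size_polyXn ltn_ord.
have L1 := slab_equation sm (fun i j => congr1 pint (mulrC _ _)).
have L2' : pint (curve_inner EB energy_coef (@dmonomials R q) (@weighted R q))
    + EB J (Y (@weighted R q) 0) = slab_load (@weighted R q).
  apply: slab_equation => [j|i j]; first exact: size_proj.
  (* Both sides are the integral of [s ^ (i + j + 1)], as the projection is invisible against
     monomials of degree at most [q]. *)
  by rewrite /weighted !pint_proj ?sm //; congr pint; rewrite /monomials; ring.
apply: (slab_bounds SE energy_coefP Pinc L1 L2').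
  apply: le_trans (ler_norm _) _; apply: slab_load_bound => // s s01.
  by rewrite yE; exact: (curve_bound SE energy_coefP).
apply: slab_load_bound => // s s01.
by rewrite yE; exact: (weighted_bound SE energy_coefP).
Qed.

Lemma slab_sup_bounds t : a < t < b ->
  [/\ (normL2 smul Om (fval (v t)) <= (curve_size EB energy_coef)%:E)%E &
      (c%:E * normL2 dot Om (grad (u t)) <= (curve_size EB energy_coef)%:E)%E].
Proof.
move=> tab; set y := curve_size EB energy_coef.
have y0 : 0 <= y by exact: sqrtr_ge0.
have K0 : 0 <= rkernel_bound q :> R by exact: le_trans ler01 (rkernel_bound_ge1 q).
set s := (local_var a b).[t]; have s01 := local_var_itv tab.
have ey : EB (Y (@monomials R q) s) (Y (@monomials R q) s) <= y ^+ 2.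
  rewrite sqr_sqrtr; first exact: (curve_bound SE energy_coefP).
  by rewrite mulr_ge0 // (curve_mean_ge0 SE energy_coefP).
have [h1 h2] : L2pair Om (Y (@monomials R q) s).
  exact: (curve_in SE energy_coefP).
have -> : fval (v t) = (Y (@monomials R q) s).1.
  rewrite curve_fst vE // fval_sum; apply: eq_bigr => j _.
  by rewrite horner_comp.
have -> : grad (u t) = (Y (@monomials R q) s).2.
  rewrite curve_snd uE // grad_sum; apply: eq_bigr => j _.
  by rewrite horner_comp.
split; first by rewrite normL2_smulE // lee_fin; exact: energy_fst_le.
by rewrite normL2_dotE // -EFinM lee_fin; exact: energy_snd_le.
Qed.

Lemma slab_outgoing :
  (trace_left (fun t => fval (v t)) b, trace_left (fun t => grad (u t)) b) =
  Y (@monomials R q) 1.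
Proof.
rewrite (slab_curve_left ab (fval_slab vE)) (slab_curve_left ab (grad_slab uE)).
by rewrite -curve_fst -curve_snd; case: (Y _ _).
Qed.

End slab_step.
(** * Summation over the time slabs *)

Section time_integrals.
Context {R : realType} (T : R) (N : nat) (ts : nat -> R).
Hypothesis hts : time_partition T N ts.

Lemma time_partition_cover t : 0 < t < T ->
  (forall n, (n <= N)%N -> t != ts n) ->
  exists2 n, (n < N)%N & ts n < t < ts n.+1.
Proof.
have [t0 tN inc] := hts => /andP[tgt0 tT] tn.
suff H k : (k <= N)%N -> t < ts k -> exists2 n, (n < k)%N & ts n < t < ts n.+1.
  by apply: H => //; rewrite tN.
elim: k => [|k ih] kN tk; first by move: tk; rewrite t0 ltNge (ltW tgt0).
have [tk'|tk'] := ltP t (ts k).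
  by have [n nk h] := ih (ltnW kN) tk'; exists n => //; exact: ltnW.
exists k => //; rewrite tk andbT lt_neqAle tk' andbT eq_sym.
exact: tn (ltnW kN).
Qed.

(** Superadditivity of the lower integral is enough, since the slab integrals only have to be
    bounded from above. *)
Lemma slab_integrals_le (g : R -> \bar R) : (forall t, (0 <= g t)%E) ->
  (\int[lebesgue_measure]_(t in `]0%R, T[) g t < +oo)%E ->
  (forall n, (n < N)%N ->
     (\int[lebesgue_measure]_(t in `]ts n, ts n.+1[) g t < +oo)%E) /\
  \sum_(n < N) fine (\int[lebesgue_measure]_(t in `]ts n, ts n.+1[) g t)%E
  <= fine (\int[lebesgue_measure]_(t in `]0%R, T[) g t)%E.
Proof.
move=> g0 goo; have [t0 tN inc] := hts.
pose I n := (\int[lebesgue_measure]_(t in `]ts n, ts n.+1[) g t)%E.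
have I0 n : (0 <= I n)%E by exact: integral_ge0.
have H k : (k <= N)%N ->
    (\sum_(n < k) I n <= \int[lebesgue_measure]_(t in `]0%R, ts k[) g t)%E.
  elim: k => [|k ih] kN; first by rewrite big_ord0 integral_ge0.
  rewrite big_ord_recr /=; apply: le_trans (leeD (ih (ltnW kN)) (le_refl _)) _.
  have k0 : 0 <= ts k.
    by rewrite -t0; apply: (time_partition_le hts) => //; exact: ltnW.
  apply: ge0_lower_integral_superadd => //.
  - by apply: subset_itvl; rewrite bnd_simp ltW // inc.
  - by apply: subset_itvr; rewrite bnd_simp.
  - apply/seteqP; split => // t [] /=; rewrite !in_itv /=.
    move=> /andP[_ h1] /andP[h2 _].
    by move: (lt_trans h1 h2); rewrite ltxx.
have HN := H N (leqnn N); rewrite tN in HN.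
have fin n : (n < N)%N -> I n \is a fin_num.
  move=> nN; rewrite ge0_fin_numE //; apply: le_lt_trans goo; apply: le_trans HN.
  rewrite (bigD1 (Ordinal nN)) //= leeDl // sume_ge0 // => i _; exact: I0.
split; first by move=> n nN; have := fin n nN; rewrite ge0_fin_numE.
rewrite -lee_fin fineK; last by rewrite ge0_fin_numE // integral_ge0.
apply: le_trans HN; rewrite -sumEFin le_eqVlt; apply/orP; left; apply/eqP.
by apply: eq_bigr => n _; exact/fineK/fin.
Qed.

Lemma ess_sup_slabs (g : R -> \bar R) (M : \bar R) : (0 <= M)%E ->
  (forall n t, (n < N)%N -> ts n < t < ts n.+1 -> (g t <= M)%E) ->
  (ess_sup lebesgue_measure (g \_ `]0%R, T[) <= M)%E.
Proof.
move=> M0 gM; apply/ess_supP.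
(* The exceptional null set consists of the nodes, where the bound on the open slabs says
   nothing. *)
exists (ts @` `I_N.+1); split.
- apply: countable_measurable => //; apply: finite_set_countable.
  by apply: finite_image; exact: finite_II.
- apply: countable_lebesgue_measure0; apply: finite_set_countable.
  by apply: finite_image; exact: finite_II.
- move=> t /= h; apply: contrapT => ht; apply: h.
  rewrite /patch; case: ifPn => // /set_mem; rewrite /= in_itv /= => tT.
  have [n nN tn] : exists2 n, (n < N)%N & ts n < t < ts n.+1.
    apply: time_partition_cover => // n nN; apply: contra_notN ht => /eqP ->.
    by exists n.
  exact: gM nN tn.
Qed.

End time_integrals.

(** Every section of a measurable subset of the product is measurable, so the claim holds at each
    time and not just at almost every one. *)
Lemma section_measurable (R : realType) d (Om : set 'rV[R]_d) (T : R)
    (f : R -> 'rV[R]_d -> R) (t : R) : measurable Om ->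
  L2_QT Om T f -> 0 < t < T -> measurable_fun Om (f t).
Proof.
move=> mOm [mf _] tT _ B mB.
have mQ : measurable (Om `*` (`]0, T[%classic : set (measurableTypeR R))).
  exact: measurableX.
have := measurable_ysection t (mf mQ B mB).
rewrite (_ : ysection _ _ = Om `&` f t @^-1` B) //.
apply/seteqP; split => x; rewrite /ysection /= in_setE /=.
  by move=> [[]].
by move=> [Ox Bx]; split => //; split => //=; rewrite in_itv.
Qed.

(** * From the slabs to the whole time interval *)

Section global_estimate.
Context {R : realType} {d : nat} (q : nat).
Local Notation S := (sobolev R d).
Context (Om : set 'rV[R]_d) (mOm : measurable Om).
Context (Th : {fset {fset 'rV[R]_d}}) (p : nat).
Context (T : R) (N : nat) (ts : nat -> R) (hts : time_partition T N ts).
Context (c : R) (hc : 0 < c).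

Lemma Vdisc_local (v : R -> S) : Vdisc Om Th p N ts q v ->
  exists V : nat -> 'I_q.+1 -> S, forall n, (n < N)%N ->
    (forall j, Vh Om Th p (V n j)) /\
    forall t, ts n < t < ts n.+1 ->
      v t = \sum_j (monomials j \Po local_var (ts n) (ts n.+1)).[t] *: V n j.
Proof.
move=> hv; have [_ _ inc] := hts.
suff /choice[V HV] : forall n, exists V : 'I_q.+1 -> S, (n < N)%N ->
    (forall j, Vh Om Th p (V j)) /\
    forall t, ts n < t < ts n.+1 ->
      v t = \sum_j (monomials j \Po local_var (ts n) (ts n.+1)).[t] *: V j.
  by exists V.
move=> n; have [nN|nN] := boolP (n < N)%N; last by exists (fun=> 0).
have [phi [Hphi vphi]] := hv n nN.
have [m mP] := local_monomials phi (inc n nN).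
exists (fun j => \sum_i m j i *: phi i) => _; split.
  by move=> j; exact: Vh_sum.
by move=> t tn; rewrite vphi // mP.
Qed.

Context (f : R -> 'rV[R]_d -> R) (hf : L2_QT Om T f).
Context (u0 : S) (hu0 : H10 Om u0) (v0 : 'rV[R]_d -> R) (hv0 : L2 Om v0).
Context (Ups : R -> S) (hUps : L2_H10 Om T Ups).
Context (u v : R -> S).
Hypotheses (hu : Vdisc Om Th p N ts q u) (hv : Vdisc Om Th p N ts q v).
Hypothesis eq1 : forall z : R -> sobolev R d, Vdisc Om Th p N ts q z ->
  c ^+ 2 * inner_slab dot Om 0 T (fun t => grad (v t)) (fun t => grad (z t))
  = c ^+ 2 * Dtau dot Om N ts (fun t => grad (u t)) (fun t => grad (z t))
    - c ^+ 2 * innerL2 dot Om (grad u0)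
                 (trace_right (fun t => grad (z t)) 0)
    + c ^+ 2 * inner_slab dot Om 0 T (fun t => grad (Ups t))
                 (fun t => grad (z t)).
Hypothesis eq2 : forall w : R -> sobolev R d, Vdisc Om Th p N ts q w ->
  Dtau smul Om N ts (fun t => fval (v t)) (fun t => fval (w t))
  + c ^+ 2 * inner_slab dot Om 0 T (fun t => grad (u t)) (fun t => grad (w t))
  = inner_slab smul Om 0 T f (fun t => fval (w t))
    + innerL2 smul Om v0 (trace_right (fun t => fval (w t)) 0).
Hypotheses (foo : (normL1L2 smul Om T f < +oo)%E)
  (Uoo : (normL1L2 dot Om T (fun t => grad (Ups t)) < +oo)%E).

Local Notation K := (@rkernel_bound R q).
Local Notation e0 :=
  (innerL2 smul Om v0 v0 + c ^+ 2 * innerL2 dot Om (grad u0) (grad u0)).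
Local Notation Dt := (fine (normL1L2 smul Om T f)
  + c * fine (normL1L2 dot Om T (fun t => grad (Ups t)))).

Lemma global_estimate :
  let M := 2 * (2 * K + 4 * K ^+ 2) * e0
           + (8 * K + 8 * K ^+ 2) ^+ 2 * Dt ^+ 2 in
  (normLooL2 smul Om T (fun t => fval (v t)) <= (Num.sqrt M)%:E)%E /\
  (c%:E * normLooL2 dot Om T (fun t => grad (u t)) <= (Num.sqrt M)%:E)%E.
Proof.
move=> M; have [t0 tN inc] := hts.
have [U HU] := Vdisc_local hu; have [V HV] := Vdisc_local hv.
pose EB := energy_form Om c.
pose W n := energy_coef (U n) (V n).
pose inc_ n : S := if n is k.+1 then curve (W k) (@monomials R q) 1
                  else (v0, grad u0).
pose y n := curve_size EB (W n).
pose J n := curve (W n) (@monomials R q) 0 - inc_ n.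
pose If n := (\int[lebesgue_measure]_(t in `]ts n, ts n.+1[)
   normL2 smul Om (f t))%E.
pose IU n := (\int[lebesgue_measure]_(t in `]ts n, ts n.+1[)
   normL2 dot Om (grad (Ups t)))%E.
pose D n := fine (If n) + c * fine (IU n).
have SE := semi_inner_energy c mOm; have [_ _ _ _ EBge0] := SE.
have PW n j : (n < N)%N -> L2pair Om (W n j).
  move=> nN; have [hU _] := HU n nN; have [hV _] := HV n nN.
  exact: (energy_coefP hU hV).
have Pinc n : (n <= N)%N -> L2pair Om (inc_ n).
  case: n => [|n] nN; first by split => //; case: hu0 => [[]].
  by apply: (curve_in SE) => j; exact: PW.
have incE n : (n < N)%N -> incoming ts n u v u0 v0 = inc_ n.
  case: n => [//|n] nN; have [hU uE] := HU n (ltnW nN).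
  have [hV vE] := HV n (ltnW nN).
  exact: (slab_outgoing hts (ltnW nN) uE vE).
have [fS fSum] := slab_integrals_le hts (fun t => normL2_ge0 Om smul (f t)) foo.
have [US USum] :=
  slab_integrals_le hts (fun t => normL2_ge0 Om dot (grad (Ups t))) Uoo.
have step n : (n < N)%N ->
    EB (inc_ n.+1) (inc_ n.+1) + Num.sqrt (EB (J n) (J n)) ^+ 2
      <= EB (inc_ n) (inc_ n) + 2 * (y n * D n) /\
    y n ^+ 2 <= K * (EB (inc_ n.+1) (inc_ n.+1)
      + 2 * (Num.sqrt (EB (J n) (J n)) * y n) + 2 * (y n * D n)).
  move=> nN; have [hU uE] := HU n nN; have [hV vE] := HV n nN.
  have mf t : ts n < t < ts n.+1 -> measurable_fun Om (f t).
    move=> tn; apply: (section_measurable mOm hf).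
    exact: (slab_subset hts nN tn).
  have LU t : ts n < t < ts n.+1 -> L2vec Om (grad (Ups t)).
    move=> tn; have [h _ _] := hUps.
    by have [[]] := h t (slab_subset hts nN tn).
  have := @slab_step_bounds R d q Om mOm Th p T N ts hts c hc n nN (U n) (V n)
    hU hV u v uE vE f u0 v0 Ups hu0 hv0 eq1 eq2 mf LU (fS n nN) (US n nN).
  rewrite incE //; apply; exact: Pinc (ltnW nN).
have K1 : 1 <= K by exact: rkernel_bound_ge1.
have Ige0 n : 0 <= fine (If n).
  by apply/fine_ge0/integral_ge0 => t _; exact: normL2_ge0.
have IUge0 n : 0 <= fine (IU n).
  by apply/fine_ge0/integral_ge0 => t _; exact: normL2_ge0.
have D0 n : 0 <= D n by rewrite addr_ge0 // mulr_ge0 // ltW.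
have Dsum : \sum_(n < N) D n <= Dt.
  by rewrite big_split -mulr_sumr lerD // ler_wpM2l // ltW.
have rec := @dg_recursion R K N (fun n => EB (inc_ n) (inc_ n))
  (fun n => Num.sqrt (EB (J n) (J n))) y D Dt K1
  (fun n _ => EBge0 _) (fun n _ => sqrtr_ge0 _) (fun n _ => D0 n) Dsum
  (fun n nN => (step n nN).1) (fun n nN => (step n nN).2).
have yM n : (n < N)%N -> y n <= Num.sqrt M.
  move=> nN; rewrite -[y n]ger0_norm ?sqrtr_ge0 // -sqrtr_sqr ler_wsqrtr //.
  exact: rec.
have sup n t : (n < N)%N -> ts n < t < ts n.+1 ->
  [/\ (normL2 smul Om (fval (v t)) <= (y n)%:E)%E &
      (c%:E * normL2 dot Om (grad (u t)) <= (y n)%:E)%E].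
  move=> nN tn; have [hU uE] := HU n nN; have [hV vE] := HV n nN.
  exact: (slab_sup_bounds mOm hc hU hV uE vE tn).
split.
  apply: (ess_sup_slabs hts); first by rewrite lee_fin sqrtr_ge0.
  move=> n t nN tn; have [h _] := sup n t nN tn; apply: le_trans h _.
  by rewrite lee_fin yM.
rewrite -lee_pdivlMl //; apply: (ess_sup_slabs hts).
  by rewrite mule_ge0 // lee_fin ?sqrtr_ge0 // invr_ge0 ltW.
move=> n t nN tn; have [_ h] := sup n t nN tn; rewrite lee_pdivlMl //.
by apply: le_trans h _; rewrite lee_fin yM.
Qed.

End global_estimate.

Theorem proposition8p2 (R : realType) (q : nat) (hq : (1 <= q)%N) :
  exists C : R, 0 < C /\
  forall (d : nat) (hd : (1 <= d <= 3)%N)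
    (Om : set 'rV[R]_d) (hOm : polytopic_domain Om)
    (Th : {fset {fset 'rV[R]_d}}) (hTh : conforming_mesh Om Th)
    (sigma : R) (hsigma : shape_regular sigma Th)
    (T : R) (hT : 0 < T)
    (N : nat) (ts : nat -> R) (hts : time_partition T N ts)
    (p : nat) (hp : (1 <= p)%N)
    (c : R) (hc : 0 < c)
    (f : R -> 'rV[R]_d -> R) (hf : L2_QT Om T f)
    (u0 : sobolev R d) (hu0 : H10 Om u0)
    (v0 : 'rV[R]_d -> R) (hv0 : L2 Om v0)
    (Ups : R -> sobolev R d) (hUps : L2_H10 Om T Ups)
    (u v : R -> sobolev R d)
    (hu : Vdisc Om Th p N ts q u) (hv : Vdisc Om Th p N ts q v),
    (forall z : R -> sobolev R d, Vdisc Om Th p N ts q z ->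
       c ^+ 2 * inner_slab dot Om 0 T (fun t => grad (v t)) (fun t => grad (z t))
       = c ^+ 2 * Dtau dot Om N ts (fun t => grad (u t)) (fun t => grad (z t))
         - c ^+ 2 * innerL2 dot Om (grad u0)
                      (trace_right (fun t => grad (z t)) 0)
         + c ^+ 2 * inner_slab dot Om 0 T (fun t => grad (Ups t))
                      (fun t => grad (z t))) ->
    (forall w : R -> sobolev R d, Vdisc Om Th p N ts q w ->
       Dtau smul Om N ts (fun t => fval (v t)) (fun t => fval (w t))
       + c ^+ 2 * inner_slab dot Om 0 T (fun t => grad (u t)) (fun t => grad (w t))
       = inner_slab smul Om 0 T f (fun t => fval (w t))
         + innerL2 smul Om v0 (trace_right (fun t => fval (w t)) 0)) ->
    (normLooL2 smul Om T (fun t => fval (v t)) ^+ 2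
     + (c ^+ 2)%:E * normLooL2 dot Om T (fun t => grad (u t)) ^+ 2
     <= C%:E * (normL1L2 smul Om T f ^+ 2
                + (c ^+ 2)%:E * normL1L2 dot Om T (fun t => grad (Ups t)) ^+ 2
                + normL2 smul Om v0 ^+ 2
                + (c ^+ 2)%:E * normL2 dot Om (grad u0) ^+ 2))%E.
Proof.
pose K := @rkernel_bound R q.
(* Both squared norms on the left are bounded by the same [M], which gives a factor 2; splitting the
   square of the sum of the two data norms gives another 2 in the second summand. *)
pose C := 4 * (2 * K + 4 * K ^+ 2) + 4 * (8 * K + 8 * K ^+ 2) ^+ 2.
have K1 : 1 <= K by exact: rkernel_bound_ge1.
have C0 : 0 < C.
  have K0 : 0 < K by exact: lt_le_trans ltr01 K1.
  apply: ltr_pwDl; last by rewrite mulr_ge0 // sqr_ge0.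
  by rewrite mulr_gt0 // addr_gt0 // mulr_gt0 // exprn_gt0.
exists C; split => //.
move=> d hd Om hOm Th hTh sigma hsigma T hT N ts hts p hp c hc f hf u0 hu0 v0 hv0.
move=> Ups hUps u v hu hv eq1 eq2.
have mOm : measurable Om.
  by case: hOm => _ _ [P ->]; apply: open_measurable_rV; exact: open_interior.
have L1ge0 (V : normedModType R) (ip : V -> V -> R) g :
    (0 <= normL1L2 ip Om T g)%E.
  by apply: integral_ge0 => t _; exact: normL2_ge0.
have Looge0 (V : normedModType R) (ip : V -> V -> R) g :
    (0 <= normLooL2 ip Om T g)%E.
  (* An essential supremum of nonnegative values is nonnegative only over a space of positive
     measure, here certified by [0, 1]. *)
  apply: ess_sup_gee; last first.
    by apply: aeW => t; apply: erestrict_ge0 => s _; exact: normL2_ge0.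
  have l01 :
      (lebesgue_measure (`[0%R, 1%R] : set R) <= lebesgue_measure [set: R])%E.
    by apply: le_measure; rewrite ?inE.
  apply: lt_le_trans l01; rewrite lebesgue_measure_itv /= lte_fin ltr01.
  by rewrite -EFinB subr0 lte_fin.
set F := normL1L2 smul Om T f; set G := normL1L2 dot Om T _.
have F0 : (0 <= F)%E by exact: L1ge0.
have G0 : (0 <= G)%E by exact: L1ge0.
have su0 : L2vec Om (grad u0) by case: hu0 => [[]].
have c20 : (0 <= (c ^+ 2)%:E)%E by rewrite lee_fin sqr_ge0.
have [_ _ _ _ p1] := semi_inner_L2 mOm; have [_ _ _ _ p2] := semi_inner_L2vec mOm.
rewrite (normL2_smulE mOm hv0) (normL2_dotE mOm su0) -!EFin_expe !sqr_sqrtr //.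
set a := innerL2 smul Om v0 v0; set b := innerL2 dot Om (grad u0) (grad u0).
have a0 : 0 <= a by exact: p1.
have b0 : 0 <= b by exact: p2.
have nN (x : \bar R) : (0 <= x)%E -> x != -oo%E by case: x.
(* If a data norm is infinite, then so is the right side, because [C] and [c] are positive. *)
have [FE|Ffin] := eqVneq F +oo%E.
  rewrite FE [(+oo ^+ 2)%E]expe2 mulyy -!addeA addye ?gt0_muley ?lte_fin ?leey //.
  apply: nN.
  by rewrite !adde_ge0 ?mule_ge0 ?expe_ge0 ?lee_fin // mulr_ge0 ?sqr_ge0.
have [GE|Gfin] := eqVneq G +oo%E.
  rewrite GE [(+oo ^+ 2)%E]expe2 mulyy [(_ * +oo)%E]gt0_muley ?lte_fin ?exprn_gt0 //.
  rewrite addey ?nN ?expe_ge0 //.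
  by rewrite -!addeA addye ?gt0_muley ?lte_fin ?leey //.
have Foo : (F < +oo)%E by rewrite ltey.
have Goo : (G < +oo)%E by rewrite ltey.
have [] := global_estimate mOm hts hc hf hu0 hv0 hUps hu hv eq1 eq2 Foo Goo.
rewrite -/F -/G -/K -/a -/b; set M := _ + _.
have := Looge0 _ smul (fun t => fval (v t)).
have := Looge0 _ dot (fun t => grad (u t)).
move: (normLooL2 smul _ _ _) (normLooL2 dot _ _ _) => x z.
pose A := 2 * (2 * K + 4 * K ^+ 2); pose B := (8 * K + 8 * K ^+ 2) ^+ 2.
have K0 : 0 <= K by exact: le_trans ler01 K1.
have A0 : 0 <= A by rewrite mulr_ge0 // addr_ge0 // mulr_ge0 // sqr_ge0.
have B0 : 0 <= B by exact: sqr_ge0.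
have CE : C = 2 * A + 4 * B by rewrite /C /A /B; ring.
have cb0 : 0 <= c ^+ 2 * b by rewrite mulr_ge0 // sqr_ge0.
have ME : M = A * (a + c ^+ 2 * b) + B * (fine F + c * fine G) ^+ 2 by [].
have M0 : 0 <= M by rewrite ME addr_ge0 // mulr_ge0 ?addr_ge0 ?sqr_ge0.
have FR : F = (fine F)%:E by rewrite fineK // ge0_fin_numE.
have GR : G = (fine G)%:E by rewrite fineK // ge0_fin_numE.
rewrite FR GR -!EFin_expe.
set r := (C%:E * _)%E.
have {r}-> : r =
  (C * (fine F ^+ 2 + c ^+ 2 * fine G ^+ 2 + a + c ^+ 2 * b))%:E by [].
move=> z0 x0 xM zM.
have xf : x \is a fin_num by rewrite ge0_fin_numE // (le_lt_trans xM) // ltry.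
have zf : z \is a fin_num.
  by case: z z0 zM => [z| |] // _; rewrite gt0_muley ?lte_fin // leye_eq.
move: z0 x0 xM zM; rewrite -(fineK xf) -(fineK zf).
move: (fine x) (fine z) => {xf}x {zf}z.
rewrite -EFinM -!EFin_expe -!EFinM -EFinD !lee_fin => z0 x0 xM zM.
have sM2 : Num.sqrt M ^+ 2 = M by rewrite sqr_sqrtr.
have x2 : x ^+ 2 <= M.
  by rewrite -sM2 ler_sqr ?nnegrE ?sqrtr_ge0.
have z2 : c ^+ 2 * z ^+ 2 <= M.
  by rewrite -exprMn -sM2 ler_sqr ?nnegrE ?sqrtr_ge0 // mulr_ge0 // ltW.
have sq : (fine F + c * fine G) ^+ 2 <= 2 * (fine F ^+ 2 + c ^+ 2 * fine G ^+ 2).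
  by have := sqr_ge0 (fine F - c * fine G); lra.
have Bsq := ler_wpM2l B0 sq.
have S1 : 0 <= fine F ^+ 2 + c ^+ 2 * fine G ^+ 2.
  by apply: addr_ge0; [|apply: mulr_ge0]; exact: sqr_ge0.
have P1 := mulr_ge0 A0 S1; have P2 := mulr_ge0 B0 (addr_ge0 a0 cb0).
rewrite CE; lra.
Qed.
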